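(* There is a constant $K\ge 1$ such that the standard slit carpet $\mathbb{M}_\infty$ admits a $(1,K)$-bi-Lipschitz embedding into $L^1([0,1])$.
   Context: A map $f:(X,d_X)\to(Y,d_Y)$ is $(a,b)$-bi-Lipschitz if $a\,d_X(x,y)\le d_Y(f(x),f(y))\le b\,d_X(x,y)$ for all $x,y\in X$. $L^1([0,1])$ is the space of Lebesgue integrable functions on $[0,1]$ with its usual norm. Construction of $\mathbb{M}_\infty$. Let $M_0=\mathbb{M}_0=[0,1]^2$. For $n\ge1$ and $l,k\in\{0,\dots,2^n-1\}$ let $s^n_{l,k}$ be the closed vertical segment (slit) with endpoints $((2l+1)2^{-n-1},(4k+1)2^{-n-2})$ and $((2l+1)2^{-n-1},(4k+3)2^{-n-2})$. Recursively, $M_n:=M_{n-1}\setminus\bigcup_{l,k}s^n_{l,k}$. Equip $M_n$ with its path metric (infimum of Euclidean lengths of paths in $M_n$ joining two points); $(\mathbb{M}_n,d_{\mathbb{M}_n})$ is the metric completion. The inclusion $M_n\to M_{n-1}$ extends to a surjective $1$-Lipschitz map $\pi_{n,n-1}:\mathbb{M}_n\to\mathbb{M}_{n-1}$. The standard slit carpet $\mathbb{M}_\infty$ is the inverse limit: the set of sequences $(x_k)_{k\ge0}$ with $x_k\in\mathbb{M}_k$ and $\pi_{n,n-1}(x_n)=x_{n-1}$ for all $n\ge1$, with metric $d((x_k),(y_k))=\lim_{k\to\infty}d_{\mathbb{M}_k}(x_k,y_k)$ (an increasing limit). *)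

(* Defs.v *)
From HB Require Import structures.
From mathcomp Require Import all_boot all_order all_algebra.
From mathcomp Require Import generic_quotient ring lra.
From mathcomp Require Import all_classical all_reals all_analysis.
From mathcomp Require Import measurable_realfun.

Set Implicit Arguments.
Unset Strict Implicit.
Unset Printing Implicit Defensive.

Import Order.TTheory GRing.Theory Num.Theory.
Import numFieldNormedType.Exports.

Local Open Scope classical_set_scope.
Local Open Scope ring_scope.
Local Open Scope quotient_scope.

Definition bi_lipschitz {R : realType} {X Y : metricType R} (a b : R)
    (f : X -> Y) :=
  forall x y : X, a * mdist x y <= mdist (f x) (f y) <= b * mdist x y.

Section completion.
Context {R : realType} (X : metricType R).

Lemma cauchy_mdistP (u : nat -> X) : cauchy (u @ \oo) <->
  forall e : R, 0 < e -> \forall m & n \near \oo, mdist (u m) (u n) < e.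
Proof.
rewrite -cauchy_ballP; split=> h e e0; have := h e e0; near_simpl;
  by apply: filterS => -[m n]; rewrite /= ballEmdist.
Qed.

Definition cauchy_seq : Type := [set u : nat -> X | cauchy (u @ \oo)].

Lemma mdist_lip (x y x' y' : X) :
  `|mdist x y - mdist x' y'| <= mdist x x' + mdist y y'.
Proof.
have h (a b a' b' : X) : mdist a b - mdist a' b' <= mdist a a' + mdist b b'.
  rewrite lerBlDr (le_trans (metric_triangle a a' b))// -addrA lerD2l.
  by rewrite addrC (metric_sym b b') metric_triangle.
rewrite ler_norml h andbT lerNl opprB.
by rewrite (metric_sym x x') (metric_sym y y') h.
Qed.

Lemma is_cvg_mdist (u v : nat -> X) : cauchy (u @ \oo) -> cauchy (v @ \oo) ->
  cvgn (fun k => mdist (u k) (v k)).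
Proof.
move=> /cauchy_mdistP cu /cauchy_mdistP cv.
apply/cauchy_cvgP/cauchy_ballP => e e0; near_simpl.
have e20 : 0 < e / 2 by rewrite divr_gt0.
have := cu _ e20; have := cv _ e20; apply: filter_app2; near=> m n => h1 h2.
rewrite /ball/= (le_lt_trans (mdist_lip _ _ _ _))//.
by rewrite [e]splitr ltrD.
Unshelve. all: by end_near. Qed.

Definition cauchy_equiv (u v : cauchy_seq) : bool :=
  `[< mdist (val u k) (val v k) @[k --> \oo] --> (0 : R) >].

Lemma cauchy_equiv_refl : reflexive cauchy_equiv.
Proof.
move=> u; apply/asboolP; apply: cvg_near_cst.
by apply: nearW => k; rewrite mdistxx.
Qed.

Lemma cauchy_equiv_sym : symmetric cauchy_equiv.
Proof.
move=> u v; rewrite /cauchy_equiv.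
by under eq_fun do rewrite metric_sym.
Qed.

Lemma cauchy_equiv_trans : transitive cauchy_equiv.
Proof.
move=> v u w /asboolP uv /asboolP vw; apply/asboolP.
apply: (@squeeze_cvgr _ _ _ _ (cst 0)
  (fun k => mdist (val u k) (val v k) + mdist (val v k) (val w k))).
- by apply: nearW => k; rewrite mdist_ge0 metric_triangle.
- exact: cvg_cst.
- by rewrite -[X in _ --> X]addr0; exact: cvgD.
Qed.

Canonical cauchy_equiv_canonical :=
  EquivRel cauchy_equiv cauchy_equiv_refl cauchy_equiv_sym cauchy_equiv_trans.

(* The metric completion: Cauchy sequences modulo vanishing mutual distance. *)
Definition completion : Type := {eq_quot cauchy_equiv}.
HB.instance Definition _ := Choice.on completion.
HB.instance Definition _ := EqQuotient.on completion.

Definition completion_dist (x y : completion) : R :=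
  limn (fun k => mdist (val (repr x) k) (val (repr y) k)).

Lemma cauchy_seqP (u : cauchy_seq) : cauchy (val u @ \oo).
Proof. exact: (set_mem (valP u)). Qed.

Lemma cvg_completion_dist x y :
  mdist (val (repr x) k) (val (repr y) k) @[k --> \oo] --> completion_dist x y.
Proof. exact: (is_cvg_mdist (cauchy_seqP _) (cauchy_seqP _)). Qed.

Arguments cvg_completion_dist : clear implicits.

Lemma cauchy_equiv_repr (u : cauchy_seq) :
  mdist (val (repr (\pi_completion u)) k) (val u k) @[k --> \oo] --> (0 : R).
Proof.
have : repr (\pi_completion u) = u %[mod completion] by rewrite reprK.
by move/eqquotP/asboolP.
Qed.

Arguments cauchy_equiv_repr : clear implicits.

Lemma completion_dist_pi (u v : cauchy_seq) :
  mdist (val u k) (val v k) @[k --> \oo] -->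
  completion_dist (\pi_completion u) (\pi_completion v).
Proof.
have h := cvg_completion_dist (\pi_completion u) (\pi_completion v).
apply: cvg_sub0 h; apply/norm_cvg0P.
rewrite -[0]addr0.
apply: (squeeze_cvgr _ (cvg_cst _)
  (cvgD (cauchy_equiv_repr u) (cauchy_equiv_repr v))).
apply: nearW => k /=; rewrite addr0 normr_ge0/=.
apply: le_trans (mdist_lip _ _ _ _) _.
by rewrite lerD// metric_sym.
Qed.

Arguments completion_dist_pi : clear implicits.

Lemma completion_distxx x : completion_dist x x = 0.
Proof.
apply: cvg_lim => //; apply: cvg_near_cst.
by apply: nearW => k; rewrite mdistxx.
Qed.

Lemma completion_dist_positivity x y : completion_dist x y = 0 -> x = y.
Proof.
move=> xy; rewrite -[x]reprK -[y]reprK; apply/eqquotP/asboolP.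
by rewrite -xy; exact: cvg_completion_dist.
Qed.

Lemma completion_dist_sym x y : completion_dist x y = completion_dist y x.
Proof. by rewrite /completion_dist; under eq_fun do rewrite metric_sym. Qed.

Lemma completion_dist_triangle y x z :
  completion_dist x z <= completion_dist x y + completion_dist y z.
Proof.
apply: (ler_cvg_to (cvg_completion_dist x z)
  (cvgD (cvg_completion_dist x y) (cvg_completion_dist y z))).
by apply: nearW => k; exact: metric_triangle.
Qed.

HB.instance Definition _ := isMetric.Build R completion
  completion_distxx completion_dist_positivity completion_dist_sym
  completion_dist_triangle.

End completion.

Arguments cvg_completion_dist {R X}.
Arguments cauchy_equiv_repr {R X}.
Arguments completion_dist_pi {R X}.

Section completion_lift.
Context {R : realType} (X Y : metricType R) (f : X -> Y).
Hypothesis f_lip1 : forall x y, mdist (f x) (f y) <= mdist x y.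

Lemma cauchy_lip1 (u : cauchy_seq X) : cauchy ((f \o val u) @ \oo).
Proof.
apply/cauchy_mdistP => e e0.
have /cauchy_mdistP /(_ _ e0) := cauchy_seqP u.
by apply: filterS => -[m n] /=; exact: le_lt_trans.
Qed.

Definition cauchy_seq_map (u : cauchy_seq X) : cauchy_seq Y :=
  exist _ (f \o val u) (mem_set (cauchy_lip1 u)).

(* The continuous extension of f: [completion_lift_pi] shows that it acts on
   Cauchy sequences termwise. *)
Definition completion_lift (x : completion X) : completion Y :=
  \pi_(completion Y) (cauchy_seq_map (repr x)).

Lemma completion_lift_pi (u : cauchy_seq X) :
  completion_lift (\pi_(completion X) u) = \pi_(completion Y) (cauchy_seq_map u).
Proof.
apply/eqquotP/asboolP.
apply: (squeeze_cvgr _ (cvg_cst _) (cauchy_equiv_repr u)).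
by apply: nearW => k; rewrite mdist_ge0 f_lip1.
Qed.

Lemma completion_lift_lip1 (x y : completion X) :
  mdist (completion_lift x) (completion_lift y) <= mdist x y.
Proof.
apply: (ler_cvg_to (completion_dist_pi _ _) (cvg_completion_dist x y)).
by apply: nearW => k; exact: f_lip1.
Qed.

End completion_lift.

Section L1_metric.
Context d (T : measurableType d) (R : realType).
Variable mu : {measure set T -> \bar R}.

(* LspaceType1 quotients measurable functions by a.e. equality but carries no
   norm structure in the library; L1_dist f g is the L^1 norm of f - g. *)
Definition L1_space : Type := LspaceType1 mu.

HB.instance Definition _ := gen_eqMixin L1_space.
HB.instance Definition _ := gen_choiceMixin L1_space.

Definition L1_fun (f : L1_space) : T -> R := (f : LspaceType1 mu).

Lemma L1_fun_finite (f : L1_space) : finite_norm mu 1 (L1_fun f).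
Proof. exact: Lebesgue_finite. Qed.

Lemma measurable_L1_fun (f : L1_space) : measurable_fun setT (L1_fun f).
Proof. exact: (@measurable_funPT _ _ _ _ (repr (LebesgueSpace.sort f))). Qed.

Definition L1_dist (f g : L1_space) : R :=
  fine 'N[mu]_1[EFin \o (L1_fun f \- L1_fun g)%R].

Lemma L1_dist_fineK (f g : L1_space) :
  (L1_dist f g)%:E = 'N[mu]_1[EFin \o (L1_fun f \- L1_fun g)%R]%E.
Proof.
rewrite /L1_dist fineK// ge0_fin_numE ?Lnorm_ge0//.
have mf := measurable_L1_fun f; have mg := measurable_L1_fun g.
apply: le_lt_trans (eminkowski mu mf (measurable_funN mg) (lexx _)) _.
rewrite lte_add_pinfty//; first exact: L1_fun_finite.
rewrite (_ : _ \o _ = \- (EFin \o L1_fun g))%E// oppe_Lnorm.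
exact: L1_fun_finite.
Qed.

Lemma L1_distxx f : L1_dist f f = 0.
Proof.
apply: EFin_inj; rewrite L1_dist_fineK.
rewrite (_ : _ \o _ = cst 0%E) ?Lnorm0//.
by apply/funext => x /=; rewrite subrr.
Qed.

Lemma L1_dist_positivity f g : L1_dist f g = 0 -> f = g.
Proof.
move=> fg0.
have fg : L1_fun f = L1_fun g %[ae mu].
  have : 'N[mu]_1[EFin \o (L1_fun f \- L1_fun g)%R]%E = 0%E.
    by rewrite -L1_dist_fineK fg0.
  move=> /Lnorm_eq0_eq0.
  have h : measurable_fun setT (EFin \o (L1_fun f \- L1_fun g)).
    apply/measurable_EFinP/measurable_funB; exact: measurable_L1_fun.
  move=> /(_ h) /(_ lte01); apply: filterS => x /[apply] -[] /eqP.
  by rewrite subr_eq0 => /eqP.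
have : LebesgueSpace.sort f = LebesgueSpace.sort g.
  by rewrite -[LHS]reprK -[RHS]reprK; apply/eqP/ae_eqP.
case: f g {fg0 fg} => [f [[f1]]] [g [[g1]]] /= fg; case: _ / fg g1 => g1.
by rewrite (Prop_irrelevance f1 g1).
Qed.

Lemma L1_dist_sym f g : L1_dist f g = L1_dist g f.
Proof.
rewrite /L1_dist -oppe_Lnorm; congr (fine (Lnorm _ _ _)); apply/funext => x /=.
by rewrite opprB.
Qed.

Lemma L1_dist_triangle g f h : L1_dist f h <= L1_dist f g + L1_dist g h.
Proof.
rewrite -lee_fin EFinD !L1_dist_fineK.
rewrite (_ : L1_fun f \- L1_fun h =
  (L1_fun f \- L1_fun g) \+ (L1_fun g \- L1_fun h)); last first.
  by apply/funext => x /=; rewrite addrA subrK.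
by apply: eminkowski => //; apply: measurable_funB; exact: measurable_L1_fun.
Qed.

HB.instance Definition _ := isMetric.Build R L1_space
  L1_distxx L1_dist_positivity L1_dist_sym L1_dist_triangle.

End L1_metric.

Section plane_curves.
Context {R : realType}.
Implicit Types (p q r : R * R) (f g : R -> R * R) (s : seq R) (a b c : R).
Implicit Type A : set (R * R).

(* The norm that the library puts on R * R is the sup norm. *)
Definition eudist p q : R :=
  Num.sqrt ((p.1 - q.1) ^+ 2 + (p.2 - q.2) ^+ 2).

(* Length of the polygon with vertices f a, f s_0, f s_1, ...; compare
   [variation] and [total_variation] for real-valued functions. *)
Definition inscribed_length f a s : R :=
  \sum_(0 <= k < size s) eudist (f (a :: s)`_k) (f s`_k).

Definition curve_length a b f : \bar R :=
  ereal_sup [set (inscribed_length f a s)%:E | s in itv_partition a b].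

Definition is_path A p q f :=
  [/\ {within `[0, 1], continuous f}, f 0 = p, f 1 = q &
      f @` `[0, 1] `<=` A].

Definition path_edist A p q : \bar R :=
  ereal_inf [set curve_length 0 1 f | f in is_path A p q].

Definition path_dist A p q : R := fine (path_edist A p q).

Lemma eudist_ge0 p q : 0 <= eudist p q.
Proof. exact: sqrtr_ge0. Qed.

Lemma eudistC p q : eudist p q = eudist q p.
Proof. by rewrite /eudist; congr Num.sqrt; ring. Qed.

Lemma eudistxx p : eudist p p = 0.
Proof. by rewrite /eudist !subrr expr0n addr0 sqrtr0. Qed.

Lemma eudist_eq0 p q : eudist p q = 0 -> p = q.
Proof.
move=> /eqP; rewrite sqrtr_eq0 => h.
have h1 := sqr_ge0 (p.1 - q.1); have h2 := sqr_ge0 (p.2 - q.2).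
have /eqP : (p.1 - q.1) ^+ 2 = 0 by lra.
have /eqP : (p.2 - q.2) ^+ 2 = 0 by lra.
rewrite !sqrf_eq0 !subr_eq0; case: p q {h h1 h2} => [? ?] [? ?] /=.
by move=> /eqP -> /eqP ->.
Qed.

Lemma eudist_triangle q p r : eudist p r <= eudist p q + eudist q r.
Proof.
rewrite -(@ler_pXn2r _ 2) ?nnegrE ?addr_ge0 ?eudist_ge0// sqrrD.
rewrite !sqr_sqrtr ?addr_ge0 ?sqr_ge0//.
set x := p.1 - q.1; set y := p.2 - q.2; set z := q.1 - r.1; set w := q.2 - r.2.
have -> : p.1 - r.1 = x + z by rewrite /x /z; ring.
have -> : p.2 - r.2 = y + w by rewrite /y /w; ring.
have h : x * z + y * w <= eudist p q * eudist q r.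
  rewrite /eudist -sqrtrM ?addr_ge0 ?sqr_ge0// -/x -/y -/z -/w.
  apply: le_trans (ler_norm _) _; rewrite -sqrtr_sqr ler_sqrt; last first.
    by rewrite mulr_ge0 ?addr_ge0 ?sqr_ge0.
  by rewrite -subr_ge0 (_ : _ - _ = (x * w - y * z) ^+ 2) ?sqr_ge0//; ring.
lra.
Qed.

Lemma inscribed_length_cons f a b s :
  inscribed_length f a (b :: s) = eudist (f a) (f b) + inscribed_length f b s.
Proof. by rewrite /inscribed_length /= big_nat_recl. Qed.

Lemma inscribed_length_nil f a : inscribed_length f a [::] = 0.
Proof. by rewrite /inscribed_length big_nil. Qed.

Lemma inscribed_length_rcons f a s b : inscribed_length f a (rcons s b) =
  inscribed_length f a s + eudist (f (last a s)) (f b).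
Proof.
elim: s a => [|c s IH] a /=.
  by rewrite inscribed_length_cons !inscribed_length_nil addrC.
by rewrite !inscribed_length_cons IH addrA.
Qed.

Lemma eq_inscribed_length f g a s : {in a :: s, f =1 g} ->
  inscribed_length f a s = inscribed_length g a s.
Proof.
elim: s a => [|c s IH] a fg; first by rewrite !inscribed_length_nil.
rewrite !inscribed_length_cons IH ?fg ?inE ?eqxx ?orbT//.
by move=> x xs; apply: fg; rewrite inE xs orbT.
Qed.

Lemma itv_partition_in a b s : itv_partition a b s ->
  {in a :: s, forall x, x \in `[a, b]}.
Proof.
move=> [+ /eqP <-] {b}; elim: s a => [|c s IH] a /=.
  by move=> _ x; rewrite inE => /eqP ->; rewrite in_itv/= !lexx.
move=> /andP[ac cs] x; rewrite inE => /predU1P[->|xs].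
  have := IH _ cs c; rewrite mem_head in_itv/= => /(_ isT) /andP[_ h].
  by rewrite in_itv/= lexx (le_trans (ltW ac)).
have := IH _ cs x xs; rewrite !in_itv/= => /andP[h ->]; rewrite andbT.
by rewrite (le_trans (ltW ac)).
Qed.

Lemma eq_curve_length f g a b : {in `[a, b], f =1 g} ->
  curve_length a b f = curve_length a b g.
Proof.
move=> fg; rewrite /curve_length; congr ereal_sup; apply/eq_imagel => s /= abs.
congr (_%:E); apply: eq_inscribed_length => x xs; apply: fg.
exact: itv_partition_in xs.
Qed.

Lemma inscribed_length_split f a s c : path <%R a s -> a < c -> c < last a s ->
  exists s1 s2, [/\ itv_partition a c s1, itv_partition c (last a s) s2 &
    inscribed_length f a s <= inscribed_length f a s1 + inscribed_length f c s2].
Proof.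
elim: s a => [|x s IH] a /=.
  by move=> _ ac ca; have := lt_trans ac ca; rewrite ltxx.
move=> /andP[ax xs] ac cl; have [xc|cx|xc] := ltgtP x c.
- have [s1 [s2 [[p1 l1] p2 h]]] := IH _ xs xc cl.
  exists (x :: s1), s2; split => //; first by split; rewrite //= ax.
  by rewrite !inscribed_length_cons -addrA lerD2l.
- exists [:: c], (x :: s); split; first exact: itv_partition1.
    by split; rewrite //= cx.
  rewrite !inscribed_length_cons inscribed_length_nil addr0 addrA lerD2r.
  exact: eudist_triangle.
- subst c; exists [:: x], s; split; [exact: itv_partition1|by split|].
  by rewrite !inscribed_length_cons inscribed_length_nil addr0.
Qed.

Lemma curve_length_ub f a b s : itv_partition a b s ->
  ((inscribed_length f a s)%:E <= curve_length a b f)%E.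
Proof. by move=> abs; apply: ereal_sup_ubound; exists s. Qed.

Lemma curve_length_cat f a b c : a < c -> c < b ->
  (curve_length a b f <= curve_length a c f + curve_length c b f)%E.
Proof.
move=> ac cb; apply: ge_ereal_sup => _ [s [abs /eqP lb] <-].
have := @inscribed_length_split f a s c abs ac; rewrite lb => /(_ cb).
move=> [s1 [s2 [p1 p2 h]]]; rewrite -lee_fin in h; apply: le_trans h _.
by rewrite EFinD leeD// curve_length_ub.
Qed.

Lemma inscribed_length_map f (phi : R -> R) a s :
  inscribed_length (f \o phi) a s = inscribed_length f (phi a) (map phi s).
Proof.
elim: s a => [|x s IH] a /=; first by rewrite !inscribed_length_nil.
by rewrite !inscribed_length_cons IH.
Qed.

Lemma curve_length_comp f (phi : R -> R) a b : {homo phi : x y / x < y} ->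
  (curve_length a b (f \o phi) <= curve_length (phi a) (phi b) f)%E.
Proof.
move=> hphi; apply: ge_ereal_sup => _ [s [abs /eqP lb] <-].
rewrite inscribed_length_map; apply: curve_length_ub; split.
  exact: homo_path abs.
by rewrite last_map lb.
Qed.

Lemma inscribed_length_rev f (phi : R -> R) a s : {homo phi : x y /~ x < y} ->
  path <%R a s ->
  exists2 s', itv_partition (phi (last a s)) (phi a) s' &
  inscribed_length f (phi (last a s)) s' = inscribed_length (f \o phi) a s.
Proof.
move=> hphi; elim: s a => [|x s IH] a /=.
  by move=> _; exists [::]; rewrite ?inscribed_length_nil//; split.
move=> /andP[ax /IH[s' [p' /eqP l'] h']]; exists (rcons s' (phi a)).
  by split; rewrite ?last_rcons// rcons_path p' l' hphi.
by rewrite inscribed_length_rcons inscribed_length_cons h' l' addrC eudistC.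
Qed.

Lemma curve_length_rev f (phi : R -> R) a b : {homo phi : x y /~ x < y} ->
  (curve_length a b (f \o phi) <= curve_length (phi b) (phi a) f)%E.
Proof.
move=> hphi; apply: ge_ereal_sup => _ [s [abs /eqP lb] <-].
have [s'] := inscribed_length_rev f hphi abs.
by rewrite lb => abs' <-; exact: curve_length_ub.
Qed.

Lemma eudist_curve_length f a b : a < b ->
  ((eudist (f a) (f b))%:E <= curve_length a b f)%E.
Proof.
move=> ab; have := curve_length_ub f (itv_partition1 ab).
by rewrite inscribed_length_cons inscribed_length_nil addr0.
Qed.

Definition segment_path p q (t : R) : R * R :=
  (p.1 + t * (q.1 - p.1), p.2 + t * (q.2 - p.2)).

Lemma eudist_segment p q a b : a <= b ->
  eudist (segment_path p q a) (segment_path p q b) = (b - a) * eudist p q.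
Proof.
move=> ab; rewrite /eudist /=.
rewrite (_ : _ + _ = (b - a) ^+ 2 * ((p.1 - q.1) ^+ 2 + (p.2 - q.2) ^+ 2)).
  by rewrite sqrtrM ?sqr_ge0// sqrtr_sqr ger0_norm ?subr_ge0.
by ring.
Qed.

Lemma curve_length_segment p q a b :
  (curve_length a b (segment_path p q) <= ((b - a) * eudist p q)%:E)%E.
Proof.
apply: ge_ereal_sup => _ [s [abs /eqP <-] <-] {b}; rewrite lee_fin.
elim: s a abs => [|x s IH] a /=.
  by rewrite inscribed_length_nil subrr mul0r.
move=> /andP[ax xs]; rewrite inscribed_length_cons eudist_segment; last exact: ltW.
rewrite (_ : (last x s - a) * _ = (x - a) * eudist p q +
  (last x s - x) * eudist p q); last by ring.
by rewrite lerD2l IH.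
Qed.

Lemma segment_path_continuous p q : continuous (segment_path p q).
Proof.
move=> t; apply: (@cvg_pair _ _ _ (nbhs t) (nbhs _) (nbhs _)).
- apply: cvgD; first exact: cvg_cst.
  by apply: cvgM; [exact: cvg_id|exact: cvg_cst].
- apply: cvgD; first exact: cvg_cst.
  by apply: cvgM; [exact: cvg_id|exact: cvg_cst].
Qed.

Lemma path_edist_ge A p q : ((eudist p q)%:E <= path_edist A p q)%E.
Proof.
apply: le_ereal_inf_tmp => _ [f [_ <- <- _] <-]; exact: eudist_curve_length.
Qed.

Lemma path_edist_ge0 A p q : (0 <= path_edist A p q)%E.
Proof. by apply: le_trans (path_edist_ge A p q); rewrite lee_fin eudist_ge0. Qed.

Lemma path_edist_sub A B p q : A `<=` B ->
  (path_edist B p q <= path_edist A p q)%E.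
Proof.
move=> AB; apply: le_ereal_inf => _ [f [cf f0 f1 fA] <-]; exists f => //.
by split=> //; exact: subset_trans fA AB.
Qed.

Lemma path_edist_segment A p q :
  (forall t, t \in `[0, 1] -> A (segment_path p q t)) ->
  (path_edist A p q <= (eudist p q)%:E)%E.
Proof.
move=> h; have := curve_length_segment p q 0 1; rewrite subr0 mul1r.
apply: le_trans; apply: ereal_inf_lbound; exists (segment_path p q) => //; split.
- exact/continuous_subspaceT/segment_path_continuous.
- by case: p q {h} => [? ?] [? ?]; rewrite /segment_path !mul0r !addr0.
- case: p q {h} => [? ?] [? ?]; rewrite /segment_path !mul1r/=.
  by congr (_, _); ring.
- by move=> _ [t t01 <-]; exact: h.
Qed.

Lemma within_continuous_comp_sub (I J : set R) (phi : R -> R) f :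
  continuous phi -> (forall t, I t -> J (phi t)) ->
  {within J, continuous f} -> {within I, continuous (f \o phi)}.
Proof.
move=> cphi IJ /subspace_continuousP cf; apply/subspace_continuousP => t It.
apply: cvg_comp (cf _ (IJ _ It)) => U.
move=> hU; have {hU}: nbhs t [set u | J (phi u) -> U (phi u)] := cphi t _ hU.
rewrite /= => hU; suff : nbhs t [set u | I u -> U (phi u)] by [].
by apply: filterS hU => u /= h Iu; exact/h/IJ.
Qed.

Lemma is_path_rev A p q f :
  is_path A p q f -> is_path A q p (f \o (fun t => 1 - t)).
Proof.
have h01 (t : R) : `[0, 1]%classic t -> `[0, 1]%classic (1 - t).
  by rewrite /= !in_itv/= => /andP[? ?]; apply/andP; lra.
move=> [cf f0 f1 fA]; split.
- apply: within_continuous_comp_sub h01 cf => t.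
  by apply: cvgB; [exact: cvg_cst|exact: cvg_id].
- by rewrite /= subr0.
- by rewrite /= subrr.
- by move=> _ [t /h01 t01 <-]; apply: fA; exists (1 - t).
Qed.

Lemma path_edist_sym A p q : path_edist A p q = path_edist A q p.
Proof.
have h p' q' : (path_edist A p' q' <= path_edist A q' p')%E.
  apply: le_ereal_inf_tmp => _ [f pf <-].
  have homo : {homo (fun t : R => 1 - t) : x y /~ x < y} by move=> x y; lra.
  have := @curve_length_rev f _ 0 1 homo; rewrite subr0 subrr.
  apply: le_trans; apply: ereal_inf_lbound.
  by exists (f \o (fun t => 1 - t)) => //; exact: is_path_rev.
by apply/eqP; rewrite eq_le !h.
Qed.

Definition cat_path f g (t : R) : R * R :=
  if t <= 2^-1 then f (2 * t) else g (2 * t - 1).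

Lemma cat_pathL f g : {in `[0, 2^-1], cat_path f g =1 f \o (fun t => 2 * t)}.
Proof. by move=> t; rewrite in_itv/= /cat_path => /andP[_ ->]. Qed.

Lemma cat_pathR f g : f 1 = g 0 ->
  {in `[2^-1, 1], cat_path f g =1 g \o (fun t => 2 * t - 1)}.
Proof.
move=> fg t; rewrite in_itv/= /cat_path => /andP[t2 _]; case: ifPn => // t2'.
have -> : t = 2^-1 by apply/eqP; rewrite eq_le t2' t2.
by rewrite mulfV// subrr.
Qed.

Lemma is_path_cat A p q r f g : is_path A p q f -> is_path A q r g ->
  is_path A p r (cat_path f g).
Proof.
move=> [cf f0 f1 fA] [cg g0 g1 gA].
have fg : f 1 = g 0 by rewrite f1 g0.
have hL (t : R) : `[0, 2^-1]%classic t -> `[0, 1]%classic (2 * t).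
  by rewrite /= !in_itv/= => /andP[? ?]; apply/andP; lra.
have hR (t : R) : `[2^-1, 1]%classic t -> `[0, 1]%classic (2 * t - 1).
  by rewrite /= !in_itv/= => /andP[? ?]; apply/andP; lra.
have U01 : `[0, 1]%classic = `[0, 2^-1] `|` `[2^-1, 1] :> set R.
  apply/seteqP; split => t /=; rewrite !in_itv/=.
    move=> /andP[-> ->]; case: (leP t 2^-1) => h; first by left.
    by right; rewrite (ltW h).
  by move=> [] /andP[? ?]; apply/andP; split; clear fA gA cf cg; lra.
split.
- rewrite U01; apply: withinU_continuous.
  + exact: interval_closed.
  + exact: interval_closed.
  + apply: (@subspace_eq_continuous _ _ _ (f \o (fun t => 2 * t))).
      by move=> t; rewrite inE => t01; exact/esym/cat_pathL.
    apply: within_continuous_comp_sub hL cf => t.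
    by apply: cvgM; [exact: cvg_cst|exact: cvg_id].
  + apply: (@subspace_eq_continuous _ _ _ (g \o (fun t => 2 * t - 1))).
      by move=> t; rewrite inE => t01; exact/esym/(cat_pathR fg).
    apply: within_continuous_comp_sub hR cg => t.
    apply: cvgB; last exact: cvg_cst.
    by apply: cvgM; [exact: cvg_cst|exact: cvg_id].
- by rewrite cat_pathL/= ?mulr0// in_itv/= lexx invr_ge0 ler0n.
- rewrite cat_pathR//= ?in_itv/= ?lexx ?andbT ?invf_le1 ?ler1n//.
  by rewrite mulr1 (_ : 2 - 1 = 1)//; ring.
- move=> _ [t + <-]; rewrite U01 => -[] t01.
    by rewrite cat_pathL//; apply: fA; exists (2 * t) => //; exact: hL.
  by rewrite cat_pathR//; apply: gA; exists (2 * t - 1) => //; exact: hR.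
Qed.

Lemma curve_length_cat_path f g : f 1 = g 0 ->
  (curve_length 0 1 (cat_path f g) <= curve_length 0 1 f + curve_length 0 1 g)%E.
Proof.
move=> fg; have h0 : 0 < 2^-1 :> R by lra.
have h1 : 2^-1 < 1 :> R by lra.
apply: le_trans (curve_length_cat _ h0 h1) _.
rewrite (eq_curve_length (@cat_pathL f g)) (eq_curve_length (cat_pathR fg)).
have homoL : {homo (fun t : R => 2 * t) : x y / x < y} by move=> x y; lra.
have homoR : {homo (fun t : R => 2 * t - 1) : x y / x < y} by move=> x y; lra.
apply: leeD; apply: le_trans (curve_length_comp _ _ _ _) _ => //.
- by rewrite mulr0 mulfV.
- by rewrite mulfV// subrr (_ : 2 * 1 - 1 = 1)//; ring.
Qed.

Lemma path_edist_triangle A q p r :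
  (path_edist A p r <= path_edist A p q + path_edist A q r)%E.
Proof.
have [pq|pq] := eqVneq (path_edist A p q) +oo%E.
  by rewrite pq addye ?leey// gt_eqF// (lt_le_trans _ (path_edist_ge0 _ _ _)).
have [qr|qr] := eqVneq (path_edist A q r) +oo%E.
  by rewrite qr addey ?leey// gt_eqF// (lt_le_trans _ (path_edist_ge0 _ _ _)).
have fpq : path_edist A p q \is a fin_num.
  by rewrite ge0_fin_numE ?path_edist_ge0// ltey.
have fqr : path_edist A q r \is a fin_num.
  by rewrite ge0_fin_numE ?path_edist_ge0// ltey.
apply/lee_addgt0Pr => e e0; have e20 : 0 < e / 2 by lra.
have [_ [f pf <-] hf] := lb_ereal_inf_adherent e20 fpq.
have [_ [g pg <-] hg] := lb_ereal_inf_adherent e20 fqr.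
have fg : f 1 = g 0 by case: pf pg => _ _ -> _ [_ -> _ _].
apply: (@le_trans _ _ (curve_length 0 1 (cat_path f g))).
  by apply: ereal_inf_lbound; exists (cat_path f g) => //; exact: is_path_cat pf pg.
apply: le_trans (curve_length_cat_path fg) _.
rewrite [e]splitr EFinD addeACA; apply: leeD; exact: ltW.
Qed.

End plane_curves.

Section slit_domains.
Context {R : realType}.
Implicit Types (p q : R * R) (n m l k : nat).

Definition slit n l k : set (R * R) :=
  [set p | p.1 = (2 * l + 1)%:R / 2 ^+ n.+1 /\
           (4 * k + 1)%:R / 2 ^+ n.+2 <= p.2 <= (4 * k + 3)%:R / 2 ^+ n.+2].

Fixpoint slit_set n : set (R * R) :=
  if n is m.+1 then
    slit_set m `\`
      \bigcup_(l in [set: 'I_(2 ^ n)]) \bigcup_(k in [set: 'I_(2 ^ n)]) slit n l k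
  else `[0, 1] `*` `[0, 1].

Definition slit_abscissa n (x : R) :=
  exists m l, [/\ (m <= n)%N, (l < 2 ^ m)%N & x = (2 * l + 1)%:R / 2 ^+ m.+1].

Lemma slit_abscissa_int n x : slit_abscissa n x ->
  x < 1 /\ exists z : int, x * 2 ^+ n.+1 = z%:~R.
Proof.
move=> [m [l [mn lm ->]]]; split.
  rewrite ltr_pdivrMr ?exprn_gt0// mul1r -natrX ltr_nat expnS.
  by rewrite addn1 !mul2n ltn_Sdouble.
exists ((2 * l + 1) * 2 ^ (n - m))%N%:Z.
rewrite -pmulrn natrM natrX -[in LHS](subnK mn) -addnS exprD.
by rewrite mulrCA divfK ?expf_neq0 ?pnatr_eq0// mulrC.
Qed.

Lemma slit_abscissa_avoid n x : 0 <= x <= 1 -> exists x',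
  [/\ x <= x' <= 1, (forall t, x < t <= x' -> ~ slit_abscissa n t) &
      ~ slit_abscissa n x'].
Proof.
move=> /andP[x0]; rewrite le_eqVlt => /predU1P[->|x1].
  exists 1; split; first by rewrite lexx.
  - by move=> t /andP[t1 /(lt_le_trans t1)]; rewrite ltxx.
  - by move=> /slit_abscissa_int[]; rewrite ltxx.
pose N : R := 2 ^+ n.+1; have N0 : 0 < N by rewrite exprn_gt0.
pose z := Num.floor (x * N).
have zx : z%:~R <= x * N := floor_le_tmp _.
have xz : x * N < (z + 1)%:~R := floorD1_gt _.
have zN : (z + 1)%:~R <= N.
  rewrite /N -natrX pmulrn ler_int lezD1 -(ltr_int R) -pmulrn natrX.
  by rewrite (le_lt_trans zx)// -[ltRHS]mul1r ltr_pM2r.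
pose y := (z + 1)%:~R / N.
have xy : x < y by rewrite ltr_pdivlMr.
have y1 : y <= 1 by rewrite ler_pdivrMr// mul1r.
have avoid t : x < t <= (x + y) / 2 -> ~ slit_abscissa n t.
  move=> /andP[xt ty] /slit_abscissa_int[_ [w tw]].
  have ty' : t < y by lra.
  have h1 : z < w.
    by rewrite -(ltr_int R) -tw (le_lt_trans zx)// ltr_pM2r.
  have h2 : w < z + 1 by rewrite -(ltr_int R) -tw -ltr_pdivlMr.
  by rewrite ltzD1 leNgt h1 in h2.
exists ((x + y) / 2); split => //; first by apply/andP; lra.
by apply: avoid; apply/andP; lra.
Qed.

Lemma slit_setI n x y : 0 <= x <= 1 -> 0 <= y <= 1 ->
  ~ slit_abscissa n x \/ y = 0 -> slit_set n (x, y).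
Proof.
move=> x01 y01; elim: n => [|n IH] h; first by split; rewrite /= in_itv/=.
split.
  apply: IH; case: h => [h|]; [left|by right].
  by move=> [m [l [mn lm xl]]]; apply: h; exists m, l; split => //; exact: leqW.
move=> [l _ [k _ []]] /= xl /andP[y1 _]; case: h => [h|y0].
  by apply: h; exists n.+1, l; split.
by move: y1; rewrite y0 leNgt divr_gt0// ?ltr0n ?addn1// exprn_gt0.
Qed.

Lemma slit_set_square n p : slit_set n p -> 0 <= p.1 <= 1 /\ 0 <= p.2 <= 1.
Proof.
elim: n => [|n IH]; last by move=> [/IH].
by move=> [] /=; rewrite !in_itv/=.
Qed.

Lemma slit_setS n : slit_set n.+1 `<=` slit_set n.
Proof. by move=> p []. Qed.

Lemma eudist_horizontal (x x' y : R) : 0 <= x <= 1 -> 0 <= x' <= 1 ->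
  eudist (x, y) (x', y) <= 1.
Proof.
move=> /andP[? ?] /andP[? ?]; rewrite /eudist /= subrr expr0n addr0 sqrtr_sqr.
by rewrite ler_norml; apply/andP; lra.
Qed.

Lemma eudist_vertical (x y y' : R) : 0 <= y <= 1 -> 0 <= y' <= 1 ->
  eudist (x, y) (x, y') <= 1.
Proof.
move=> /andP[? ?] /andP[? ?]; rewrite /eudist /= subrr expr0n add0r sqrtr_sqr.
by rewrite ler_norml; apply/andP; lra.
Qed.

Lemma slit_path_base n p : slit_set n p -> exists2 x' : R, 0 <= x' <= 1 &
  (path_edist (slit_set n) p (x', 0%R) <= 2%:E)%E.
Proof.
case: p => x y pn; have /= [x01 y01] := slit_set_square pn.
have [x' [/andP[xx' x'1] av av']] := slit_abscissa_avoid n x01.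
have x'01 : 0 <= x' <= 1.
  by rewrite x'1 (le_trans _ xx')//; case/andP: x01.
exists x' => //; apply: le_trans (path_edist_triangle _ (x', y) _ _) _.
have -> : (2%:E = 1%:E + 1%:E :> \bar R)%E by rewrite -EFinD.
apply: leeD.
- apply: (@le_trans _ _ (eudist (x, y) (x', y))%:E); last first.
    by rewrite lee_fin eudist_horizontal.
  apply: path_edist_segment => t; rewrite in_itv/= /segment_path/= => /andP[t0 t1].
  rewrite subrr mulr0 addr0.
  have [->|tx] := eqVneq (x + t * (x' - x)) x; first by [].
  have h1 : 0 <= t * (x' - x) by rewrite mulr_ge0// subr_ge0.
  have h2 : t * (x' - x) <= x' - x by rewrite ler_piMl// subr_ge0.
  apply: slit_setI => //.
    by move: x01 => /andP[? ?]; apply/andP; lra.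
  left; apply: av; rewrite lt_neqAle eq_sym tx/=; apply/andP; lra.
- apply: (@le_trans _ _ (eudist (x', y) (x', 0)%R)%:E); last first.
    by rewrite lee_fin eudist_vertical// lexx ler01.
  apply: path_edist_segment => t; rewrite in_itv/= /segment_path/= => /andP[t0 t1].
  rewrite subrr mulr0 addr0; apply: slit_setI => //; last by left.
  move: y01 => /andP[y0 y1].
  have h1 : 0 <= t * y by rewrite mulr_ge0.
  have h2 : t * y <= y by rewrite ler_piMl.
  by apply/andP; rewrite sub0r mulrN; lra.
Qed.

Lemma slit_path_bound n p q : slit_set n p -> slit_set n q ->
  (path_edist (slit_set n) p q <= 5%:E)%E.
Proof.
move=> /slit_path_base[x x01 px] /slit_path_base[x' x'01 qx'].
apply: le_trans (path_edist_triangle _ (x, 0) _ _) _.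
have -> : (5%:E = 2%:E + (1%:E + 2%:E) :> \bar R)%E.
  by rewrite -!EFinD; congr EFin; ring.
apply: leeD => //; apply: le_trans (path_edist_triangle _ (x', 0) _ _) _.
apply: leeD; last by rewrite path_edist_sym.
apply: (@le_trans _ _ (eudist (x, 0) (x', 0)%R)%:E); last first.
  by rewrite lee_fin eudist_horizontal.
apply: path_edist_segment => t; rewrite in_itv/= /segment_path/= => /andP[t0 t1].
rewrite subrr mulr0 addr0; apply: slit_setI => //; last by right.
  move: x01 x'01 => /andP[x0 x1] /andP[x'0 x'1].
  have h1 : 0 <= t * x' by rewrite mulr_ge0.
  have h2 : t * x' <= t by rewrite ler_piMr.
  have h3 : 0 <= (1 - t) * x by rewrite mulr_ge0// subr_ge0.
  have h4 : (1 - t) * x <= 1 - t by rewrite ler_piMr// subr_ge0.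
  by apply/andP; rewrite (_ : x + _ = (1 - t) * x + t * x'); [lra|ring].
by rewrite lexx ler01.
Qed.

Lemma slit_path_fin n p q : slit_set n p -> slit_set n q ->
  path_edist (slit_set n) p q \is a fin_num.
Proof.
move=> pn qn; rewrite ge0_fin_numE ?path_edist_ge0//.
by rewrite (le_lt_trans (slit_path_bound pn qn)) ?ltry.
Qed.

End slit_domains.
Arguments slit_set {R}.
Arguments slit {R}.

Section slit_metric.
Context {R : realType} (n : nat).

(* The set M_n as a type, with its path metric. *)
Definition slit_domain : Type := @slit_set R n.

HB.instance Definition _ := gen_eqMixin slit_domain.
HB.instance Definition _ := gen_choiceMixin slit_domain.

Implicit Types x y z : slit_domain.

Lemma slit_domainP x : slit_set n (val x).
Proof. exact: (set_mem (valP x)). Qed.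

Definition slit_dist x y : R := path_dist (slit_set n) (val x) (val y).

Lemma slit_dist_fineK x y :
  (slit_dist x y)%:E = path_edist (slit_set n) (val x) (val y).
Proof. by rewrite fineK// slit_path_fin//; exact: slit_domainP. Qed.

Lemma slit_distxx x : slit_dist x x = 0.
Proof.
apply/EFin_inj/eqP; rewrite slit_dist_fineK eq_le path_edist_ge0 andbT.
rewrite -[in leRHS](eudistxx (val x)); apply: path_edist_segment => t _.
rewrite /segment_path !subrr !mulr0 !addr0 -surjective_pairing.
exact: slit_domainP.
Qed.

Lemma slit_dist_positivity x y : slit_dist x y = 0 -> x = y.
Proof.
move=> xy; apply/val_inj/eudist_eq0/eqP; rewrite eq_le eudist_ge0 andbT.
by rewrite -lee_fin -xy slit_dist_fineK path_edist_ge.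
Qed.

Lemma slit_dist_sym x y : slit_dist x y = slit_dist y x.
Proof. by rewrite /slit_dist /path_dist path_edist_sym. Qed.

Lemma slit_dist_triangle y x z : slit_dist x z <= slit_dist x y + slit_dist y z.
Proof. by rewrite -lee_fin EFinD !slit_dist_fineK path_edist_triangle. Qed.

HB.instance Definition _ := isMetric.Build R slit_domain
  slit_distxx slit_dist_positivity slit_dist_sym slit_dist_triangle.

Lemma slit_dist_bound x y : mdist x y <= 5.
Proof.
rewrite -lee_fin [leLHS]slit_dist_fineK.
exact: (slit_path_bound (slit_domainP x) (slit_domainP y)).
Qed.

End slit_metric.
Arguments slit_domain : clear implicits.

Section slit_carpet.
Context {R : realType}.

Definition slit_completion n : Type := completion (slit_domain R n).
HB.instance Definition _ n := Metric.on (slit_completion n).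

Definition slit_incl n (x : slit_domain R n.+1) : slit_domain R n :=
  exist _ (val x) (mem_set (slit_setS (slit_domainP x))).

Lemma slit_incl_lip1 n (x y : slit_domain R n.+1) :
  mdist (slit_incl x) (slit_incl y) <= mdist x y.
Proof.
rewrite -lee_fin [leLHS]slit_dist_fineK [leRHS]slit_dist_fineK.
exact/path_edist_sub/slit_setS.
Qed.

Definition slit_proj n : slit_completion n.+1 -> slit_completion n :=
  completion_lift (@slit_incl_lip1 n).

Lemma slit_proj_lip1 n (x y : slit_completion n.+1) :
  mdist (slit_proj x) (slit_proj y) <= mdist x y.
Proof. exact: completion_lift_lip1. Qed.

Lemma slit_completion_bound n (x y : slit_completion n) : mdist x y <= 5.
Proof.
apply: (cvgr_to_le (cvg_completion_dist x y)).
by apply: nearW => k; exact: slit_dist_bound.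
Qed.

(* The inverse limit of the completions along the projections; the distances
   below are nondecreasing in n and bounded by 5. *)
Definition slit_carpet : Type :=
  [set x : forall n, slit_completion n | forall n, slit_proj (x n.+1) = x n].

HB.instance Definition _ := gen_eqMixin slit_carpet.
HB.instance Definition _ := gen_choiceMixin slit_carpet.

Definition carpet_dist (x y : slit_carpet) : R :=
  limn (fun n => mdist (val x n) (val y n)).

Lemma slit_carpetP (x : slit_carpet) n : slit_proj (val x n.+1) = val x n.
Proof. by move: n; exact: (set_mem (valP x)). Qed.

Lemma nondecreasing_carpet_dist (x y : slit_carpet) :
  nondecreasing_seq (fun n => mdist (val x n) (val y n)).
Proof.
apply/nondecreasing_seqP => n; rewrite -[val x n]slit_carpetP.
by rewrite -[val y n]slit_carpetP slit_proj_lip1.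
Qed.

Lemma cvg_carpet_dist (x y : slit_carpet) :
  mdist (val x n) (val y n) @[n --> \oo] --> carpet_dist x y.
Proof.
apply: nondecreasing_is_cvgn; first exact: nondecreasing_carpet_dist.
by exists 5 => _ [n _ <-]; exact: slit_completion_bound.
Qed.

Lemma carpet_distxx x : carpet_dist x x = 0.
Proof.
apply: cvg_lim => //; apply: cvg_near_cst.
by apply: nearW => n; rewrite mdistxx.
Qed.

Lemma carpet_dist_positivity x y : carpet_dist x y = 0 -> x = y.
Proof.
move=> xy; apply/val_inj/functional_extensionality_dep => n.
apply: mdist_positivity; apply/eqP; rewrite eq_le mdist_ge0 andbT -xy.
apply: (nondecreasing_cvgn_le (nondecreasing_carpet_dist x y)).
by apply/cvg_ex; exists (carpet_dist x y); exact: cvg_carpet_dist.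
Qed.

Lemma carpet_dist_sym x y : carpet_dist x y = carpet_dist y x.
Proof. by rewrite /carpet_dist; under eq_fun do rewrite metric_sym. Qed.

Lemma carpet_dist_triangle y x z :
  carpet_dist x z <= carpet_dist x y + carpet_dist y z.
Proof.
apply: (ler_cvg_to (@cvg_carpet_dist x z)
  (cvgD (@cvg_carpet_dist x y) (@cvg_carpet_dist y z))).
by apply: nearW => n; exact: metric_triangle.
Qed.

HB.instance Definition _ := isMetric.Build R slit_carpet
  carpet_distxx carpet_dist_positivity carpet_dist_sym carpet_dist_triangle.

End slit_carpet.
Arguments slit_carpet : clear implicits.

(* L^1([0,1]) as L^1 of the line for Lebesgue measure restricted to [0,1]:
   functions are identified when they agree almost everywhere on [0,1]. *)
Definition L1_01 (R : realType) : Type :=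
  L1_space (mrestr (@lebesgue_measure R) (measurable_itv `[0, 1])).
HB.instance Definition _ (R : realType) := Metric.on (L1_01 R).

(* Main.v *)
Require Import Defs.
From HB Require Import structures.
From mathcomp Require Import all_boot all_order all_algebra.
From mathcomp Require Import generic_quotient zify ring lra.
From mathcomp Require Import all_classical all_reals all_analysis.
From mathcomp Require Import measurable_realfun.

(* The embedding maps a point p to M (1_A(p) + x(p)/2), where x is the abscissa
   and A(p) is a subset of [0,1] obtained from a random cut of the carpet.  The
   cut starts on the left edge at height omega in [0,1], runs horizontally, and
   whenever it hits a slit it jumps by half the length of the slit, which
   exchanges the lower and the upper half of that slit; A(p) is the set of the
   omega whose cut passes below p.  Each exchange preserves Lebesgue measure, so
   |A(p) D A(q)| = |p - q| for p and q on a vertical line, while A(p) does not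
   change along a horizontal path that avoids the slits: hence A is 1-Lipschitz
   for the path metric.  Conversely the only detours that are not controlled by
   the Euclidean distance go around a single slit that is long compared with
   this distance; the length of such a detour is the distance from p to an end
   of the slit, and this is at most the measure of the set of cuts that jump
   across the height of p.

   At level n the heights are read as binary words.  Exchanging the halves of a
   slit of level m transposes the digits m+1 and m+2, and for the resulting
   permutations of the digits the leading n+1 digits of the height at level n+1
   are those at level n, so that the sets A(p) converge in measure as n grows. *)

Set Implicit Arguments.
Unset Strict Implicit.
Unset Printing Implicit Defensive.

Import Order.TTheory GRing.Theory Num.Theory.
Import numFieldNormedType.Exports.

(** * Dyadic cuts *)

(* In column X of width 2^-(n+1), the cut that starts at the height with binary
   word w (w < 2^(n+2)) has height cut_height n X w / 2^(n+2).  Up to level n the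
   permutation of the digits is the product over i = 2, ..., n+1 of the
   exchanges of digit i with a carried digit, whenever the i-th digit of the Gray
   code of X is 1; the state is the word of the first n+1 digits and the carry.
   The initial carry is the leading digit of w, so that passing to the next level
   only appends a digit to w. *)
Fixpoint cut_state (n X w : nat) : nat * bool :=
  if n is n'.+1 then
    let: (a, k) := cut_state n' X./2 w./2 in
    if odd X (+) odd X./2 then (a.*2 + k, odd w) else (a.*2 + odd w, k)
  else (nat_of_bool (odd w), odd w./2).

Definition cut_height n X w : nat :=
  (cut_state n X w).1.*2 + (cut_state n X w).2.

Lemma cut_state_lt n X w : (cut_state n X w).1 < 2 ^ n.+1.
Proof.
elim: n X w => [|n IH] X w /=; first by case: odd.
case: cut_state (IH X./2 w./2) => a k /= ak; rewrite expnS mul2n.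
by move: (2 ^ n.+1) ak => P ak; case: ifP => _ /=; [case: k|case: odd]; lia.
Qed.

Lemma cut_height_lt n X w : cut_height n X w < 2 ^ n.+2.
Proof.
have := cut_state_lt n X w; rewrite /cut_height [2 ^ n.+2]expnS mul2n; move: (2 ^ n.+1) => P.
by case: (cut_state n X w) => a [] /=; lia.
Qed.

(** The word is read back digit by digit: the last digit of [w] is either the last digit of the
    state or its carry, and the Gray code of [X] tells which. *)
Lemma cut_state_inj n X w w' : w < 2 ^ n.+2 -> w' < 2 ^ n.+2 ->
  cut_state n X w = cut_state n X w' -> w = w'.
Proof.
elim: n X w w' => [|n IH] X w w' /=.
  by case: w => [|[|[|[|?]]]]//; case: w' => [|[|[|[|?]]]].
move=> ww ww'; case E : cut_state => [a k]; case E' : cut_state => [a' k'].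
have {}IH : a = a' -> k = k' -> w./2 = w'./2.
  move=> aa kk; apply: (IH X./2).
  - by rewrite ltn_half_double -mul2n -expnS.
  - by rewrite ltn_half_double -mul2n -expnS.
  - by rewrite E E' aa kk.
move=> eqs; suff [hb hh] : odd w = odd w' /\ w./2 = w'./2.
  by rewrite -[w]odd_double_half hb hh odd_double_half.
move: eqs; case: ifP => _ [h1] h2.
  have [aa kk] : a = a' /\ k = k' by clear -h1; case: k k' h1 => [] [] /=; lia.
  by split => //; exact: IH.
have [aa kk] : a = a' /\ odd w = odd w'.
  by clear -h1; case: odd h1; case: odd => /=; lia.
by split => //; exact: IH.
Qed.

Lemma cut_height_inj n X w w' : w < 2 ^ n.+2 -> w' < 2 ^ n.+2 ->
  cut_height n X w = cut_height n X w' -> w = w'.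
Proof.
move=> ww ww' hh; apply: (@cut_state_inj n X) => //; move: hh.
rewrite /cut_height; case: cut_state => a [] /=; case: cut_state => b [] /= hh;
  by congr (_, _); lia.
Qed.

Definition cut_ord n X (w : 'I_(2 ^ n.+2)) : 'I_(2 ^ n.+2) :=
  Ordinal (cut_height_lt n X w).

Lemma cut_ord_inj n X : injective (@cut_ord n X).
Proof.
by move=> w w' /(congr1 val) /= h; apply: ord_inj; exact: cut_height_inj h.
Qed.

(** Both sides are the word [a] of the state at level [n], since a step only appends a digit to
    it. *)
Lemma cut_height_half n X w :
  cut_height n.+1 X w %/ 4 = cut_height n X./2 w./2 %/ 2.
Proof.
rewrite /cut_height /=; case: cut_state => a k; case: ifP => _ /=.
- by case: odd; case: k => /=; lia.
- by case: odd; case: k => /=; lia.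
Qed.

(** The columns [X.*2] and [X.*2.-1] share the last digit of the Gray code, namely the parity of
    [X]. The steps here and in the next lemma therefore agree, and only the parent columns [X] and
    [X.-1] differ. *)
Lemma cut_state_doubleE n X w : cut_state n.+1 X.*2 w =
  let: (a, k) := cut_state n X w./2 in
  if odd X then (a.*2 + k, odd w) else (a.*2 + odd w, k).
Proof. by rewrite /= odd_double doubleK. Qed.

Lemma cut_state_pred_doubleE n X w : 0 < X -> cut_state n.+1 X.*2.-1 w =
  let: (a, k) := cut_state n X.-1 w./2 in
  if odd X then (a.*2 + k, odd w) else (a.*2 + odd w, k).
Proof.
case: X => // X _.
by rewrite (_ : X.+1.*2.-1 = X.*2.+1)//= odd_double uphalf_double.
Qed.

(** This boundary has abscissa X/2, where no slit lies: the Gray codes of its two columns differ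
    only in a digit that level [n] does not read. *)
Lemma cut_state_dvdn n X w : 0 < X -> cut_state n (2 ^ n * X) w =
  cut_state n (2 ^ n * X).-1 w.
Proof.
elim: n w => [|n IH] w X0 //; rewrite expnS -mulnA mul2n.
rewrite cut_state_doubleE cut_state_pred_doubleE ?IH//.
by rewrite muln_gt0 expn_gt0.
Qed.

(* The boundary between the columns X.-1 and X = 2 ^ d * l.*2.+1 is the abscissa
   of the slits of level m+1, whose two halves differ by the exchange of b and k. *)
Lemma cut_height_cross m d l w : exists a r (b k : bool),
  [/\ r < 2 ^ d, cut_height (m.+1 + d) (2 ^ d * l.*2.+1).-1 w =
      (4 * a + 2 * b + k) * 2 ^ d + r &
    cut_height (m.+1 + d) (2 ^ d * l.*2.+1) w =
      (4 * a + 2 * k + b) * 2 ^ d + r].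
Proof.
(* For [d = 0] one of the two exchanged digits is still the carry. The next step writes it into the
   word on both sides, and later steps only append digits, with a common carry [t]. *)
case: d => [|d].
  rewrite addn0 mul1n /cut_height /= odd_double uphalf_double doubleK /=.
  case: cut_state => a k; case: (odd l) => /=.
    by exists a, 0, k, (odd w); rewrite !muln1 !addn0; split => //; lia.
  by exists a, 0, (odd w), k; rewrite !muln1 !addn0; split => //; lia.
rewrite /cut_height addnS.
suff [a [r [b [k [t [rd -> ->]]]]]] : exists a r (b k t : bool),
    [/\ r < 2 ^ d, cut_state (m.+1 + d).+1 (2 ^ d.+1 * l.*2.+1).-1 w =
      ((4 * a + 2 * b + k) * 2 ^ d + r, t) &
    cut_state (m.+1 + d).+1 (2 ^ d.+1 * l.*2.+1) w =
      ((4 * a + 2 * k + b) * 2 ^ d + r, t)].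
  exists a, (r.*2 + t), b, k; rewrite expnS /=.
  by move: (2 ^ d) rd => D rd; case: t b k => [] [] [] /=; split; rewrite ?mulnDl ?doubleD; nia.
have e D : 2 ^ D.+1 * l.*2.+1 = (2 ^ D * l.*2.+1).*2.
  by rewrite expnS -mulnA mul2n.
elim: d w => [|d IH] w;
  rewrite e cut_state_doubleE cut_state_pred_doubleE ?muln_gt0 ?expn_gt0//.
  rewrite addn0 mul1n /cut_height /= odd_double uphalf_double doubleK /=.
  case: cut_state => a k; case: (odd l) => /=.
    by exists a, 0, k, (odd w./2), (odd w); rewrite !muln1 !addn0; split => //;
      congr (_, _); lia.
  by exists a, 0, (odd w./2), k, (odd w); rewrite !muln1 !addn0; split => //;
    congr (_, _); lia.
rewrite addnS; have [a [r [b [k [t [rd -> ->]]]]]] := IH w./2.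
rewrite oddM oddX /=; exists a, (r.*2 + odd w), b, k, t; rewrite expnS.
by move: (2 ^ d) rd => D rd; split => //; case: odd; try congr (_, _); case: b k => [] [] /=; nia.
Qed.

(** * Counting the cuts that separate two points *)

Lemma card_ord_itv N a b : b <= N -> #|[set i : 'I_N | a <= i < b]| = b - a.
Proof.
move=> bN; rewrite cardE -(size_map val) -(size_iota a (b - a)).
apply/perm_size/uniq_perm; [|exact: iota_uniq|].
  by rewrite (map_inj_uniq (@ord_inj N)) enum_uniq.
move=> i; rewrite mem_iota; apply/mapP/idP => [[j + ->]|abi].
  by rewrite mem_enum inE /=; lia.
have iN : i < N by lia.
by exists (Ordinal iN) => //; rewrite mem_enum inE/=; lia.
Qed.

(** The discrete form of the invariance of Lebesgue measure: in each column the cuts permute the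
    heights. *)
Lemma card_cut_ord n X (P : pred nat) :
  #|[set w : 'I_(2 ^ n.+2) | P (cut_height n X w)]| = #|[set i : 'I_(2 ^ n.+2) | P i]|.
Proof.
rewrite -(card_preimset [set i : 'I__ | P i] (@cut_ord_inj n X)).
by apply: eq_card => w; rewrite !inE.
Qed.

Definition cut_set n X Y : {set _} :=
  [set w : 'I_(2 ^ n.+2) | cut_height n X w < Y].

Definition cut_diff n X Y X' Y' : {set _} :=
  [set w : 'I_(2 ^ n.+2) | (cut_height n X w < Y) (+) (cut_height n X' w < Y')].

Lemma card_cut_set n X Y : Y <= 2 ^ n.+2 -> #|cut_set n X Y| = Y.
Proof.
move=> YN; rewrite /cut_set (card_cut_ord _ X (fun i => i < Y)).
by have := card_ord_itv 0 YN; rewrite subn0.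
Qed.

Lemma card_cut_diff_row n X Y Y' : Y' <= 2 ^ n.+2 -> Y <= Y' ->
  #|cut_diff n X Y X Y'| = Y' - Y.
Proof.
move=> Y'N YY'; rewrite -(card_ord_itv Y Y'N).
rewrite /cut_diff (card_cut_ord _ X (fun i => (i < Y) (+) (i < Y'))).
by apply: eq_card => i; rewrite !inE; lia.
Qed.

(** Whatever the columns, [Y] cuts pass below one point and [Y'] below the other. *)
Lemma card_cut_diff_ge n X Y X' Y' : Y <= 2 ^ n.+2 -> Y' <= 2 ^ n.+2 ->
  Y - Y' <= #|cut_diff n X Y X' Y'|.
Proof.
move=> YN Y'N; rewrite -{1}(card_cut_set X YN) -{1}(card_cut_set X' Y'N).
rewrite leq_subLR (leq_trans _ (leq_card_setU _ _))// subset_leq_card//.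
by apply/fintype.subsetP => w; rewrite !inE; case: (_ < Y); case: (_ < Y').
Qed.

(** The leading digits of the heights agree at both levels, so the comparisons can differ only for
    the cuts whose height lies in the same block of four as [Y]. *)
Lemma card_cut_diff_level n X Y :
  #|[set w : 'I_(2 ^ n.+3) | (cut_height n.+1 X w < Y) (+)
                             (cut_height n X./2 w./2 < Y./2)]| <= 4.
Proof.
apply: (@leq_trans #|[set w : 'I_(2 ^ n.+3) |
    Y %/ 4 * 4 <= cut_height n.+1 X w < Y %/ 4 * 4 + 4]|).
  apply/subset_leq_card/fintype.subsetP => w; rewrite !inE.
  by have := cut_height_half n X w; move: cut_height; lia.
rewrite (card_cut_ord _ X (fun i => Y %/ 4 * 4 <= i < Y %/ 4 * 4 + 4)).
apply: (@leq_trans (size (iota (Y %/ 4 * 4) 4))); last by rewrite size_iota.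
rewrite cardE -(size_map val); apply: uniq_leq_size.
  by rewrite (map_inj_uniq (@ord_inj _)) enum_uniq.
by move=> _ /mapP[i + ->]; rewrite mem_enum inE mem_iota.
Qed.

(** It suffices to count the cuts that jump upward across [Y]: they reach the slit in its lower half
    below [Y] and leave it [2 ^ d] higher, at [Y] or above. Their heights on the left fill the
    interval from [L] to [U]. *)
Lemma card_cut_diff_cross m d l c Y : let n := m.+1 + d in
  let X := 2 ^ d * l.*2.+1 in
  c < 2 ^ m.+1 ->
  minn (Y - (4 * c + 1) * 2 ^ d) ((4 * c + 3) * 2 ^ d - Y) <=
    #|cut_diff n X.-1 Y X Y|.
Proof.
move=> n X cm; pose L := maxn ((4 * c + 1) * 2 ^ d) (Y - 2 ^ d).
pose U := minn Y ((4 * c + 2) * 2 ^ d).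
have UN : U <= 2 ^ n.+2.
  rewrite /U geq_min; apply/orP; right.
  rewrite /n (_ : (m.+1 + d).+2 = 2 + m.+1 + d); last by lia.
  by rewrite !expnD leq_mul2r -(leq_pmul2l (isT : 0 < 1)) /=; apply/orP; right; lia.
have := card_ord_itv L UN.
rewrite -(card_cut_ord _ X.-1 (fun i => L <= i < U)) => UL.
apply: (@leq_trans (U - L)).
  rewrite /U /L; move: (2 ^ d) => D.
  rewrite (_ : (4 * c + 3) * D = (4 * c + 1) * D + 2 * D); last by lia.
  rewrite (_ : (4 * c + 2) * D = (4 * c + 1) * D + D); last by lia.
  by move: (_ * D) => A; lia.
rewrite -UL; apply/subset_leq_card/fintype.subsetP => w; rewrite !inE.
have [a [r [b [k [rd -> ->]]]]] := cut_height_cross m d l w.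
rewrite /U /L; move: (2 ^ d) rd => D rd {UL UN}.
rewrite geq_max leq_min => /andP[/andP[lo lo'] /andP[hi hi']].
have D0 : 0 < D by lia.
have V1 : 4 * a + 2 * b + k < 4 * c + 2.
  by rewrite -(ltn_pmul2r D0); lia.
have V2 : 4 * c + 1 < (4 * a + 2 * b + k).+1.
  by rewrite -(ltn_pmul2r D0) mulSn; lia.
have [aa bb kk] : [/\ a = c, b = false & k = true].
  by split; case: b k V1 V2 {lo lo' hi hi'} => [] [] /=; lia.
subst a b k => /=; move: lo' hi hi'.
rewrite (_ : (4 * c + 2 * 1 + 0) * D = (4 * c + 2 * 0 + 1) * D + D); last by lia.
by move: (_ * D) => A; lia.
Qed.

(** * Column boundaries as odd multiples of powers of two, and gaps between slits *)

Lemma oddS_decomposition X : 0 < X -> exists d l, X = 2 ^ d * l.*2.+1.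
Proof.
move=> X0; have [q q2 ->] := pfactor_coprime (isT : prime 2) X0.
exists (logn 2 X), q./2; rewrite mulnC; congr (_ * _).
by rewrite -[LHS]odd_double_half -coprime2n q2.
Qed.

Lemma oddS_decomposition_inj d l d' l' :
  2 ^ d * l.*2.+1 = 2 ^ d' * l'.*2.+1 -> d = d' /\ l = l'.
Proof.
wlog dd' : d l d' l' / d <= d'.
  move=> h e; have [/h/(_ e)//|/ltnW/h/(_ (esym e)) [-> ->]//] := leqP d d'.
have [j ->] : exists j, d' = d + j by exists (d' - d); rewrite subnKC.
move=> /eqP; rewrite expnD -mulnA eqn_pmul2l ?expn_gt0// => /eqP.
case: j => [|j]; first by rewrite mul1n addn0 => e; split=> //; lia.
by rewrite expnS -mulnA; move: (2 ^ j * _) => u; lia.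
Qed.

(* In units of 2^-(k+2), with k = m + d, the slits of level m are the intervals
   [(4 c' + 1) 2^d, (4 c' + 3) 2^d] and the heights avoided by all the slits of
   levels greater than k are the even numbers. *)
Lemma even_below_above_slit (c d Y : nat) : 0 < 2 ^ d ->
  (4 * c + 1) * 2 ^ d <= Y <= (4 * c + 3) * 2 ^ d + 1 ->
  exists2 Z, forall c', ~~ ((4 * c' + 1) * 2 ^ d <= 2 * Z <= (4 * c' + 3) * 2 ^ d) &
  let m := minn (Y - (4 * c + 1) * 2 ^ d) ((4 * c + 3) * 2 ^ d - Y) in
  [/\ 2 * Z <= (4 * c + 4) * 2 ^ d, Y <= 2 * Z + m + 3 & 2 * Z <= Y + m + 3].
Proof.
move=> D0 Yc; set m := minn _ _.
have avoid Z : 4 * c * 2 ^ d <= 2 * Z -> 2 * Z < (4 * c + 1) * 2 ^ d \/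
    (4 * c + 3) * 2 ^ d < 2 * Z /\ 2 * Z <= (4 * c + 4) * 2 ^ d ->
    forall c', ~~ ((4 * c' + 1) * 2 ^ d <= 2 * Z <= (4 * c' + 3) * 2 ^ d).
  move: (2 ^ d) D0 {Yc m} => D D0 h1 h2 c'; apply/negP => /andP[h3 h4].
  have [cc|cc|cc] := ltngtP c' c.
  - have : (4 * c' + 4) * D <= 4 * c * D by rewrite leq_mul2r; lia.
    by lia.
  - have : (4 * c + 5) * D <= (4 * c' + 1) * D by rewrite leq_mul2r; lia.
    by lia.
  - by subst c'; lia.
have [s1|s2] := leqP (Y - (4 * c + 1) * 2 ^ d) ((4 * c + 3) * 2 ^ d - Y).
(* The nearer end of the slit is used: here [2 * Z] is the largest even number below the slit, and
   in the other case the smallest one above it. *)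
- exists (((4 * c + 1) * 2 ^ d - 1)./2).
    apply: avoid; last by left; move: (2 ^ d) D0 => D D0; lia.
    case: d D0 {Yc m s1} => [|d] _; first by rewrite expn0; lia.
    by rewrite expnS; have := expn_gt0 2 d; move: (2 ^ d) => D; lia.
  by rewrite /m (minn_idPl s1); move: (2 ^ d) D0 Yc {m s1 avoid} => D D0 Yc; split; lia.
- have h : 2 * ((4 * c + 3) * 2 ^ d)./2.+1 <= (4 * c + 4) * 2 ^ d.
    case: d D0 {Yc m s2 avoid} => [|d] _; first by rewrite expn0; lia.
    by rewrite expnS; have := expn_gt0 2 d; move: (2 ^ d) => D; lia.
  exists (((4 * c + 3) * 2 ^ d)./2.+1).
    apply: avoid; first by move: (2 ^ d) D0 => D D0; lia.
    by right; split => //; move: (2 ^ d) D0 => D D0; lia.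
  rewrite /m (minn_idPr (ltnW s2)).
  by move: (2 ^ d) D0 Yc h {m s2 avoid} => D D0 Yc h; split; lia.
Qed.

Local Open Scope classical_set_scope.
Local Open Scope ring_scope.

(** * Sets and functions of L^1 *)

Section L1_mk.
Context d (T : measurableType d) (R : realType).
Variable mu : {measure set T -> \bar R}.

(** The chosen representative of the class of [f] agrees with [f] only almost everywhere, so
    integrability has to be carried over to it. *)
Lemma exists_L1_fun (f : T -> R) : mu.-integrable setT (EFin \o f) ->
  exists g : L1_space mu, L1_fun g = f %[ae mu].
Proof.
move=> fi; have mf : measurable_fun setT f.
  by apply/measurable_EFinP; exact: measurable_int fi.
pose h : {mfun T >-> measurableTypeR R} :=
  HB.pack f (@isMeasurableFun.Build _ _ T (measurableTypeR R) f mf).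
pose q : {mfun_ mu, T >-> measurableTypeR R} := (\pi h)%qT.
have rq : (repr q : T -> R) = f %[ae mu].
  have /eqquotP/asboolP : (repr q = h
      %[mod {mfun_ mu, T >-> measurableTypeR R}])%qT by rewrite reprK.
  by [].
have fin : finite_norm mu 1 (repr q : T -> R).
  rewrite /finite_norm Lnorm1.
  have /integrableP[_] := fi.
  apply: le_lt_trans.
  rewrite le_eqVlt; apply/orP; left; apply/eqP; apply: ae_eq_integral => //.
  - apply: measurableT_comp => //; apply/measurable_EFinP.
    exact: (@measurable_funPT _ _ _ _ (repr q)).
  - apply: measurableT_comp => //; exact: measurable_int fi.
  - by apply: filterS rq => x /= rq _; rewrite rq.
exists (HB.pack_for (LspaceType1 mu) q (@isFinLebesgue.Build _ _ _ mu 1%E (lexx _) q fin)).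
exact: rq.
Qed.

Lemma L1_dist_ae (f g : L1_space mu) (u v : T -> R) :
  measurable_fun setT u -> measurable_fun setT v ->
  L1_fun f = u %[ae mu] -> L1_fun g = v %[ae mu] ->
  (mdist f g)%:E = (\int[mu]_x `|u x - v x|%:E)%E.
Proof.
move=> mu_ mv fu gv; rewrite [LHS]L1_dist_fineK Lnorm1.
apply: ae_eq_integral => //.
- apply: measurableT_comp => //; apply/measurable_EFinP.
  by apply: measurable_funB; exact: measurable_L1_fun.
- by apply/measurable_EFinP/measurableT_comp => //; exact: measurable_funB.
- by apply: filterS2 fu gv => x /= fu gv _; rewrite fu ?gv.
Qed.

End L1_mk.

(** * Distance of sets in measure, and L^1 distances of the functions M (1_A + x/2) *)

Section symmetric_difference.
Context d (T : measurableType d) (R : realType).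
Variable mu : {measure set T -> \bar R}.
Hypothesis mu1 : mu setT = 1%E.
Implicit Types A B C : set T.

Definition symdist A B : R := fine (mu (A `+` B)).

Lemma measurable_setY A B : measurable A -> measurable B -> measurable (A `+` B).
Proof.
by move=> mA mB; rewrite setY_def; apply: measurableU; exact: measurableD.
Qed.

Lemma symdist_fineK A B : measurable A -> measurable B ->
  (symdist A B)%:E = mu (A `+` B).
Proof.
move=> mA mB; rewrite fineK// ge0_fin_numE//.
apply: (@le_lt_trans _ _ 1%E); last exact: ltry.
by rewrite -mu1; apply: le_measure; rewrite ?inE//; exact: measurable_setY.
Qed.

Lemma symdist_ge0 A B : 0 <= symdist A B.
Proof. exact: fine_ge0. Qed.

Lemma symdistC A B : symdist A B = symdist B A.
Proof. by rewrite /symdist setYC. Qed.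

Lemma symdist_triangle B A C : measurable A -> measurable B -> measurable C ->
  symdist A C <= symdist A B + symdist B C.
Proof.
move=> mA mB mC; rewrite -lee_fin EFinD !symdist_fineK//.
apply: (@le_trans _ _ (mu ((A `+` B) `|` (B `+` C)))).
  apply: le_measure; rewrite ?inE; [exact: measurable_setY| |].
    by apply: measurableU; exact: measurable_setY.
  move=> w; rewrite !setY_def /=; have [?|?] := pselect (B w); tauto.
by apply: measureU2; exact: measurable_setY.
Qed.

(** As in the Borel-Cantelli lemma: [B] is the lower limit of the sets, and a point on which [A n]
    and [B] disagree changes sides between [A k] and [A k.+1] for some [k >= n]. The tail of the
    geometric series gives the factor 2. *)
Lemma symdist_liminf (A : (set T)^nat) (c : R) : (forall n, measurable (A n)) ->
  (forall n, symdist (A n) (A n.+1) <= c / 2 ^+ n) ->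
  exists2 B, measurable B & forall n, symdist (A n) B <= 2 * c / 2 ^+ n.
Proof.
move=> mA Ac; pose B := \bigcup_N \bigcap_(k in [set k | (N <= k)%N]) A k.
have mB : measurable B.
  apply: bigcup_measurable => N _; exact: bigcap_measurableType.
exists B => // n; rewrite -lee_fin symdist_fineK//.
have mF k : measurable (A k `+` A k.+1) by exact: measurable_setY.
have sub : A n `+` B `<=` \bigcup_(k in ~` `I_n) (A k `+` A k.+1).
  move=> w AnB; apply: contrapT => h.
  have {}h k : (n <= k)%N -> A k w <-> A k.+1 w.
    move=> nk; have : ~ (A k `+` A k.+1) w.
      by move=> kw; apply: h; exists k => //=; apply/negP; rewrite -leqNgt.
    rewrite setY_def /=; have [?|?] := pselect (A k w);
      have [?|?] := pselect (A k.+1 w); tauto.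
  have {}h k : A n w <-> A (n + k)%N w.
    elim: k => [|k IH]; first by rewrite addn0.
    by rewrite IH addnS; apply: h; rewrite leq_addr.
  move: AnB; rewrite setY_def /= => -[[Anw Bw]|[[N _ Bw] Anw]].
    apply: Bw; exists n => // k /= nk.
    by rewrite -(subnKC nk); exact/h.
  by apply: Anw; apply/(h N)/Bw; rewrite /= leq_addl.
apply: le_trans (measure_sigma_subadditive_tail mu mF (measurable_setY (mA n) mB) sub) _.
apply: lime_le; first exact: is_cvg_nneseries.
have c0 : 0 <= c.
  by have := le_trans (symdist_ge0 _ _) (Ac 0); rewrite expr0 divr1.
apply: nearW => m; under eq_bigr do rewrite -symdist_fineK//.
rewrite sumEFin lee_fin.
apply: (@le_trans _ _ (\sum_(n <= k < m) c / 2 ^+ k)); first exact: ler_sum.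
have [nm|/ltnW mn] := leqP n m; last first.
  by rewrite big_geq// divr_ge0// ?mulr_ge0// exprn_ge0.
suff -> : \sum_(n <= k < m) c / 2 ^+ k = 2 * c / 2 ^+ n - 2 * c / 2 ^+ m.
  by rewrite gerBl divr_ge0// ?mulr_ge0// exprn_ge0.
elim: m nm => [|m IH]; first by rewrite leqn0 => /eqP ->; rewrite big_geq// subrr.
rewrite leq_eqVlt => /predU1P[->|]; first by rewrite big_geq// subrr.
rewrite ltnS => nm; rewrite big_nat_recr//= IH// exprS.
by rewrite invfM; field; rewrite !expf_neq0.
Qed.


Lemma integral_affine_indic (D : set T) (a b : R) : measurable D ->
  0 <= a -> 0 <= b ->
  (\int[mu]_w (a * \1_D w + b)%:E = a%:E * mu D + b%:E)%E.
Proof.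
move=> mD a0 b0; under eq_integral do rewrite EFinD EFinM.
have mI : measurable_fun setT (EFin \o (\1_D : T -> R)).
  exact/measurable_EFinP/measurable_indic.
rewrite ge0_integralD//=.
- rewrite ge0_integralZl// ?integral_indic// ?setIT.
  rewrite (_ : (\int[mu]_x b%:E)%E = b%:E)// -[RHS]mule1 -mu1.
  exact: integral_cst.
- by move=> w _; rewrite mule_ge0// lee_fin.
- exact: measurable_funeM.
Qed.

Definition cut_fun (M : R) A (x : R) (w : T) : R := M * (\1_A w + x / 2).

Lemma measurable_cut_fun M A x : measurable A ->
  measurable_fun setT (cut_fun M A x).
Proof.
move=> mA; apply: measurable_funM => //; apply: measurable_funD => //;
    exact: measurable_indic.
Qed.

Lemma exists_cut_L1 M A x : measurable A ->
  exists f : L1_space mu, L1_fun f = cut_fun M A x %[ae mu].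
Proof.
move=> mA; apply: exists_L1_fun; apply/integrableP; split.
  exact/measurable_EFinP/measurable_cut_fun.
apply: (@le_lt_trans _ _ (\int[mu]_w (`|M| * \1_A w + `|M * (x / 2)|)%:E)%E).
  apply: ge0_le_integral => //.
  - by apply/measurable_EFinP/measurableT_comp => //; exact: measurable_cut_fun.
  - apply/measurable_EFinP/measurable_funD => //; apply: measurable_funM => //;
    exact: measurable_indic.
  - move=> w _; rewrite lee_fin /cut_fun mulrDr (le_trans (ler_normD _ _))//.
    by rewrite normrM [`|\1_A w|]ger0_norm.
rewrite integral_affine_indic// lte_add_pinfty ?ltry//.
rewrite lte_mul_pinfty ?lee_fin//.
apply: (@le_lt_trans _ _ 1%E); last exact: ltry.
by rewrite -mu1; apply: le_measure; rewrite ?inE.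
Qed.

Section cut_fun_bounds.
Variables (M x y : R) (A B : set T) (f g : L1_space mu).
Hypotheses (M0 : 0 <= M) (xy1 : `|x - y| <= 1).
Hypotheses (mA : measurable A) (mB : measurable B).
Hypotheses (fA : L1_fun f = cut_fun M A x %[ae mu]).
Hypotheses (gB : L1_fun g = cut_fun M B y %[ae mu]).

Let dist_fg :
  (mdist f g)%:E = (\int[mu]_w `|cut_fun M A x w - cut_fun M B y w|%:E)%E.
Proof. by apply: L1_dist_ae fA gB => //; exact: measurable_cut_fun. Qed.

Let measurable_dist :
  measurable_fun setT (fun w => `|cut_fun M A x w - cut_fun M B y w|%:E).
Proof.
apply/measurable_EFinP/measurableT_comp => //.
by apply: measurable_funB; exact: measurable_cut_fun.
Qed.

Let cutE w : cut_fun M A x w - cut_fun M B y w =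
  M * ((\1_A w - \1_B w) + (x - y) / 2).
Proof. by rewrite /cut_fun; ring. Qed.

Let indicY w : (\1_(A `+` B) w : R) = `|\1_A w - \1_B w|.
Proof.
rewrite !indicE setY_def in_setU !in_setD.
by case: (w \in A); case: (w \in B); rewrite /= ?subrr ?subr0 ?sub0r ?normrN ?normr1 ?normr0.
Qed.

Let mAB : measurable (A `+` B). Proof. exact: measurable_setY. Qed.

Lemma mdist_cut_le : mdist f g <= M * (symdist A B + `|x - y| / 2).
Proof.
rewrite mulrDr -lee_fin dist_fg EFinD EFinM symdist_fineK//.
rewrite -integral_affine_indic// ?mulr_ge0//; apply: ge0_le_integral => //.
- apply/measurable_EFinP/measurable_funD => //; apply: measurable_funM => //;
    exact: measurable_indic.
- move=> w _; rewrite lee_fin cutE indicY normrM (ger0_norm M0) -mulrDr.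
  rewrite ler_wpM2l// (le_trans (ler_normD _ _))// lerD2l normrM.
  by rewrite [`|2^-1|]ger0_norm.
Qed.

(** Where exactly one of the indicators is 1 they differ by 1, and (x - y)/2 cancels at most half of
    this. *)
Lemma symdist_le_mdist_cut : M / 2 * symdist A B <= mdist f g.
Proof.
rewrite -[leLHS]addr0 -lee_fin dist_fg EFinD EFinM symdist_fineK//.
rewrite -integral_affine_indic// ?divr_ge0//; apply: ge0_le_integral => //.
- by move=> w _; rewrite lee_fin addr0 mulr_ge0// ?divr_ge0.
- apply/measurable_EFinP/measurable_funD => //; apply: measurable_funM => //;
    exact: measurable_indic.
- move=> w _; rewrite lee_fin cutE indicY normrM (ger0_norm M0) addr0 -mulrA.
  rewrite ler_wpM2l//; move: xy1; rewrite !indicE.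
  case: (w \in A); case: (w \in B); rewrite ?subrr ?normr0 ?mulr0//= ler_norml => /andP[h1 h2];
  rewrite ?subr0 ?sub0r ?normrN ?normr1 mulr1; rewrite ler_normr; apply/orP; [left|right]; lra.
Qed.

(** Pointwise triangle inequality: the indicators contribute at most [M], and only on the symmetric
    difference. *)
Lemma dist_le_mdist_cut : M / 2 * `|x - y| <= mdist f g + M * symdist A B.
Proof.
rewrite -lee_fin EFinD dist_fg EFinM (EFinM M (symdist A B)) symdist_fineK//.
have -> : (M%:E * mu (A `+` B) = \int[mu]_w (M * \1_(A `+` B) w + 0)%:E)%E.
  by rewrite integral_affine_indic// adde0.
rewrite -ge0_integralD//; last 2 first.
- by move=> w _; rewrite lee_fin addr0 mulr_ge0.
- apply/measurable_EFinP/measurable_funD => //; apply: measurable_funM => //;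
    exact: measurable_indic.
have -> : ((M / 2)%:E * `|x - y|%:E = \int[mu]_w cst (M / 2 * `|x - y|)%:E w)%E.
  by rewrite integral_cst// mu1 mule1 EFinM.
apply: ge0_le_integral => //.
- by move=> w _; rewrite lee_fin mulr_ge0// divr_ge0.
- apply: emeasurable_funD => //.
  apply/measurable_EFinP/measurable_funD => //; apply: measurable_funM => //;
    exact: measurable_indic.
- move=> w _; rewrite -EFinD lee_fin cutE indicY normrM (ger0_norm M0) addr0 -mulrDr.
  rewrite -mulrA ler_wpM2l// -[2^-1 in leLHS](@ger0_norm _ 2^-1)// -normrM mulrC.
  have := ler_normB (\1_A w - \1_B w + (x - y) / 2) (\1_A w - \1_B w).
  by rewrite addrAC subrr add0r.
Qed.

End cut_fun_bounds.

End symmetric_difference.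

(** * Dyadic sets of cuts and their convergence in measure *)

Section cells.
Context {R : realType}.

Definition measure01 : {measure set _ -> \bar R} :=
  mrestr (@lebesgue_measure R) (measurable_itv `[0, 1]).

Lemma measure01E A : measure01 A = lebesgue_measure (A `&` `[0, 1]).
Proof. by []. Qed.

Lemma measure01T : measure01 setT = 1%E.
Proof.
rewrite measure01E setTI lebesgue_measure_itv/= lte_fin ltr01.
by rewrite -EFinB subr0.
Qed.

Definition cells (N : nat) (P : pred nat) : set R :=
  [set w | 0 <= w < 1 /\ P (Num.truncn (N%:R * w))].

Lemma cellsE N P : (0 < N)%N ->
  cells N P = \big[setU/set0]_(i < N | P i) `[i%:R / N%:R, i.+1%:R / N%:R[%classic.
Proof.
move=> N0; have N0' : 0 < N%:R :> R by rewrite ltr0n.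
apply/seteqP; split => w /=.
  move=> [/andP[w0 w1] Pw]; rewrite -bigcup_seq_cond.
  have Nw0 : 0 <= N%:R * w by rewrite mulr_ge0// ltW.
  have iN : (Num.truncn (N%:R * w) < N)%N.
    by rewrite truncn_lt_nat// gtr_pMr.
  exists (Ordinal iN) => /=; first by rewrite mem_index_enum Pw.
  have /andP[h1 h2] := truncn_itv Nw0.
  by rewrite in_itv/= ler_pdivrMr// ltr_pdivlMr// ![w * _]mulrC h1 h2.
rewrite -bigcup_seq_cond => -[i /= /andP[_ Pi]].
rewrite in_itv/= ler_pdivrMr// ltr_pdivlMr// ![w * _]mulrC => /andP[h1 h2].
split; last by rewrite (truncn_def (n := i)) ?h1.
rewrite -(pmulr_rge0 _ N0') (le_trans _ h1)//= -(ltr_pM2l N0') mulr1.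
by rewrite (lt_le_trans h2)// ler_nat.
Qed.

Lemma measurable_cells N P : (0 < N)%N -> measurable (cells N P).
Proof.
by move=> N0; rewrite cellsE//; apply: bigsetU_measurable.
Qed.

Lemma measure_cells N P : (0 < N)%N ->
  measure01 (cells N P) = (#|[pred i : 'I_N | P i]|%:R / N%:R)%:E.
Proof.
move=> N0; have N0' : 0 < N%:R :> R by rewrite ltr0n.
rewrite cellsE// measure_bigsetU_ord//=; last first.
  apply/trivIsetP => i j _ _ /eqP ij; rewrite -subset0 => w [/=].
  rewrite !in_itv/= !ler_pdivrMr// !ltr_pdivlMr// => /andP[a b] /andP[a' b'].
  apply: ij; apply/val_inj/eqP => /=; rewrite eqn_leq.
  by rewrite -[(i <= j)%N]ltnS -[(j <= i)%N]ltnS -!(ltr_nat R)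
    (le_lt_trans a b') (le_lt_trans a' b).
under eq_bigr => i _.
  rewrite measure01E setIidl; last first.
    move=> w /=; rewrite !in_itv/= => /andP[h1 h2].
    rewrite (le_trans _ h1) ?divr_ge0//= (le_trans (ltW h2))//.
    by rewrite ler_pdivrMr// mul1r ler_nat.
  rewrite lebesgue_measure_itv/= lte_fin ltr_pM2r ?invr_gt0// ltr_nat ltnSn.
  rewrite -EFinB -mulrBl -natrB// subSnn.
  over.
rewrite sumEFin sumr_const; congr (_%:E).
by rewrite div1r -[LHS]mulr_natl.
Qed.

Lemma symdist_cells N P Q : (0 < N)%N ->
  symdist measure01 (cells N P) (cells N Q) =
  #|[pred i : 'I_N | P i (+) Q i]|%:R / N%:R.
Proof.
move=> N0; have /esym/(congr1 fine)/= -> := measure_cells (fun i => P i (+) Q i) N0.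
rewrite /symdist; congr (fine (measure01 _)).
apply/seteqP; split => w; rewrite setY_def /cells /=.
  move=> [[[w01 Pw] h]|[[w01 Qw] h]]; split=> //.
    by rewrite Pw /=; apply/negP => Qw; exact: h.
  by rewrite Qw addbT; apply/negP => Pw; exact: h.
move=> [w01]; have [Pw|Pw] := boolP (P _) => /= Qw; [left|right]; split => //.
  by move=> -[_]; apply/negP.
by move=> -[_]; apply/negP.
Qed.

Lemma truncn_half (x : R) : 0 <= x -> (Num.truncn (2 * x))./2 = Num.truncn x.
Proof.
move=> x0; apply/esym/truncn_def.
have /andP[] := truncn_itv (mulr_ge0 (ler0n R 2) x0).
move: (Num.truncn _) => t; rewrite -!natr1.
have -> : t%:R = (odd t)%:R + t./2%:R * 2 :> R.
  by rewrite -[in LHS](odd_double_half t) -muln2 natrD natrM.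
have b0 : (0 : R) <= (odd t)%:R by [].
have b1 : (odd t)%:R <= (1 : R) by case: odd; rewrite ?lexx ?ler01.
by move=> h1 h2; apply/andP; split; lra.
Qed.

Lemma cells_half N P : cells N P = cells N.*2 (P \o half).
Proof.
have e w : 0 <= w -> (Num.truncn (N.*2%:R * w : R))./2 = Num.truncn (N%:R * w).
  by move=> w0; rewrite -mul2n natrM -mulrA truncn_half// mulr_ge0.
by apply/seteqP; split => w [] /[dup] /andP[w0 w1] w01 /= Pw; split;
  rewrite //= ?e// -e.
Qed.


(** The minimum puts the right edge into the last column. In contrast [ycell] reaches [2 ^ n.+2] at
    height 1, so that every cut passes below the top edge. *)
Definition xcell n (x : R) : nat :=
  minn (Num.truncn (2 ^+ n.+1 * x)) (2 ^ n.+1).-1.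

Definition ycell n (y : R) : nat := Num.truncn (2 ^+ n.+2 * y).

Lemma ycell_half n y : 0 <= y -> (ycell n.+1 y)./2 = ycell n y.
Proof.
by move=> y0; rewrite /ycell exprS -mulrA truncn_half// mulr_ge0// exprn_ge0.
Qed.

Lemma xcell_half n x : 0 <= x -> (xcell n.+1 x)./2 = xcell n x.
Proof.
move=> x0; rewrite /xcell [2 ^+ n.+2]exprS -mulrA [(2 ^ n.+2)%N]expnS mul2n.
rewrite -[in RHS]truncn_half; last by rewrite mulr_ge0// exprn_ge0.
by have := expn_gt0 2 n.+1; lia.
Qed.

Lemma ycell_le n y : y <= 1 -> (ycell n y <= 2 ^ n.+2)%N.
Proof.
move=> y1; rewrite /ycell -ltnS; case: (leP 0 y) => y0; last first.
  by rewrite (truncn0Pn _ _)// -ltNge (lt_trans _ ltr01)// pmulr_rlt0// exprn_gt0.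
have N0 : 0 <= 2 ^+ n.+2 :> R by rewrite exprn_ge0.
rewrite truncn_lt_nat ?(mulr_ge0 N0)// -[(2 ^ n.+2).+1%:R]natr1 natrX.
by rewrite ltr_pwDr// ler_piMr// exprn_ge0.
Qed.

Lemma ycell_itv n y : 0 <= y -> (ycell n y)%:R <= 2 ^+ n.+2 * y < (ycell n y)%:R + 1.
Proof.
move=> y0; have N0 : 0 <= 2 ^+ n.+2 :> R by rewrite exprn_ge0.
by have := truncn_itv (mulr_ge0 N0 y0); rewrite -[X in _ < X]natr1.
Qed.

(** The approximation of A(p) at level [n]. *)
Definition level_set n (p : R * R) : set R :=
  cells (2 ^ n.+2) (fun w => cut_height n (xcell n p.1) w < ycell n p.2)%N.

Lemma measurable_level_set n p : measurable (level_set n p).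
Proof. by apply: measurable_cells; rewrite expn_gt0. Qed.

Lemma symdist_level_set n p q : symdist measure01 (level_set n p) (level_set n q) =
  #|cut_diff n (xcell n p.1) (ycell n p.2) (xcell n q.1) (ycell n q.2)|%:R / 2 ^+ n.+2.
Proof.
rewrite symdist_cells ?expn_gt0// natrX; congr (_%:R / _).
by apply: eq_card => w; rewrite !inE.
Qed.

(** After refining the words by one digit, at most 4 of the 2^(n+3) cuts change sides. *)
Lemma symdist_level_setS n p : 0 <= p.1 -> 0 <= p.2 ->
  symdist measure01 (level_set n p) (level_set n.+1 p) <= 2^-1 / 2 ^+ n.
Proof.
move=> x0 y0; rewrite {1}/level_set cells_half -mul2n -expnS.
rewrite symdist_cells ?expn_gt0// natrX.
rewrite (_ : 2^-1 / 2 ^+ n = 4 / 2 ^+ n.+3 :> R); last first.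
  by rewrite !exprS; field; rewrite expf_neq0.
rewrite ler_pM2r ?invr_gt0 ?exprn_gt0// (ler_nat R _ 4).
apply: leq_trans (card_cut_diff_level n (xcell n.+1 p.1) (ycell n.+1 p.2)).
rewrite xcell_half// ycell_half//; apply/subset_leq_card/fintype.subsetP => w.
by rewrite !inE /= addbC.
Qed.

Lemma symdist_level_set_le n k p : 0 <= p.1 -> 0 <= p.2 ->
  symdist measure01 (level_set k p) (level_set (k + n) p) <= 1 / 2 ^+ k.
Proof.
move=> x0 y0; suff : symdist measure01 (level_set k p) (level_set (k + n) p) <=
    1 / 2 ^+ k - 1 / 2 ^+ (k + n).
  by move=> /le_trans; apply; rewrite gerBl divr_ge0// exprn_ge0.
elim: n => [|n IH]; first by rewrite addn0 subrr /symdist setYK measure0.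
apply: le_trans (symdist_triangle measure01T (measurable_level_set _ p)
  (measurable_level_set (k + n) p) (measurable_level_set _ p)) _.
apply: le_trans (lerD IH _) (_ : _ + 2^-1 / 2 ^+ (k + n) <= _).
  by rewrite addnS; exact: symdist_level_setS.
rewrite addnS exprS le_eqVlt; apply/orP; left; apply/eqP.
by field; rewrite !expf_neq0.
Qed.

End cells.

(** * The cuts are Lipschitz for the path metric *)

Section locally_dominated.
Context {R : realType}.
Variables (D : R * R -> R * R -> R).
Hypothesis D0 : forall p, D p p = 0.
Hypothesis D_sym : forall p q, D p q = D q p.
Hypothesis D_triangle : forall q p r, D p r <= D p q + D q r.

(** Continuous induction: [S] consists of the times up to which some partition has inscribed length
    at least the [D]-distance travelled. The local bound centred at [T = sup S] first puts [T] into
    [S], and then a later time as well unless [T = 1]. *)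
Lemma locally_dominated_curve_length (f : R -> R * R) :
  (forall t, 0 <= t <= 1 -> exists2 e, 0 < e &
    forall s, 0 <= s <= 1 -> `|t - s| < e -> D (f t) (f s) <= eudist (f t) (f s)) ->
  ((D (f 0) (f 1))%:E <= curve_length 0 1 f)%E.
Proof.
move=> Dloc; pose S := [set t | 0 <= t <= 1 /\ exists2 s, itv_partition 0 t s &
  D (f 0) (f t) <= inscribed_length f 0 s].
have S0 : S 0.
  split; first by rewrite lexx ler01.
  by exists [::]; rewrite ?inscribed_length_nil ?D0//; split.
have Sub : ubound S 1 by move=> t [] /andP[].
have supS : has_sup S by split; [exists 0|exists 1].
pose T := sup S.
have T01 : 0 <= T <= 1.
  by apply/andP; split; [apply: ub_le_sup S0; exists 1|apply: ge_sup => //; exists 0].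
have Sext t t' : S t -> t <= t' -> t' <= 1 -> D (f t) (f t') <= eudist (f t) (f t') ->
    S t'.
  move=> [/andP[t0 t1] [s [ps ls] hs]]; rewrite le_eqVlt => /predU1P[<-|tt'] t'1 h.
    by split; [rewrite t0|exists s].
  split; first by rewrite t'1 (le_trans t0 (ltW tt')).
  exists (rcons s t').
    split; last by rewrite last_rcons.
    by rewrite rcons_path ps (eqP ls).
  by rewrite inscribed_length_rcons (eqP ls) (le_trans (D_triangle (f t) _ _))// lerD.
have [e e0 De] := Dloc _ T01.
have [t St tT] := sup_adherent e0 supS.
have tT' : t <= T by apply: ub_le_sup St; exists 1.
have ST : S T.
  apply: (Sext t) => //; first by case/andP: T01.
  rewrite D_sym eudistC; apply: De; first by case: St.
  by rewrite ger0_norm ?subr_ge0// ltrBlDr -ltrBlDl.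
have T1 : T = 1.
  apply/eqP; rewrite eq_le; case/andP: (T01) => T0 -> /=.
  rewrite leNgt; apply/negP => T1.
  pose t' := Num.min 1 (T + e / 2).
  have e2 : 0 < e / 2 by rewrite divr_gt0.
  have Tt' : T < t' by rewrite lt_min T1 ltrDl.
  have t'1 : t' <= 1 by rewrite ge_min lexx.
  have t'e : t' <= T + e / 2 by rewrite ge_min lexx orbT.
  suff /(ub_le_sup (ex_intro _ 1 Sub)) : S t' by rewrite leNgt Tt'.
  apply: (Sext T) => //; first exact: ltW.
  apply: De; first by rewrite t'1 (le_trans T0 (ltW Tt')).
  by rewrite distrC ger0_norm ?subr_ge0 ?(ltW Tt')//; lra.
move: ST; rewrite T1 => -[_ [s ps]] /le_trans h.
by apply: le_trans (curve_length_ub f ps); rewrite lee_fin; exact: h.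
Qed.

End locally_dominated.

(** * Piecewise linear weights of the cuts and the Lipschitz estimate *)

Section upper_bound.
Context {R : realType}.
Implicit Types (x y z : R) (n X : nat).

Definition clamp z : R := Num.max 0 (Num.min 1 z).

Lemma clamp0 z : z <= 0 -> clamp z = 0.
Proof.
by move=> z0; rewrite /clamp max_l// ge_min z0 orbT.
Qed.

Lemma clamp1 z : 1 <= z -> clamp z = 1.
Proof. by move=> z1; rewrite /clamp min_l// max_r. Qed.

Lemma clamp_itv z : 0 <= clamp z <= 1.
Proof. by rewrite /clamp le_max lexx/= ge_max ler01 ge_min lexx. Qed.

Lemma clamp_id z : 0 <= z <= 1 -> clamp z = z.
Proof. by move=> /andP[z0 z1]; rewrite /clamp min_r// max_r. Qed.

Lemma le_clamp : {homo clamp : z z' / z <= z'}.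
Proof.
move=> z z' zz'; rewrite /clamp ge_max le_max lexx/= le_max; apply/orP; right.
by rewrite le_min !ge_min lexx zz' orbT.
Qed.

Lemma sum_clamp (N : nat) z : 0 <= z ->
  \sum_(i < N) clamp (z - i%:R) = Num.min z N%:R.
Proof.
move=> z0; elim: N => [|N IH]; first by rewrite big_ord0 min_r.
rewrite big_ord_recr/= IH -natr1.
have [zN|Nz] := leP z N%:R.
  by rewrite clamp0 ?subr_le0// addr0 min_l// (le_trans zN)// lerDl.
have [zN|{}Nz'] := leP z (N%:R + 1).
  by rewrite clamp_id ?subr_ge0 ?(ltW Nz) ?lerBlDl//; lra.
by rewrite clamp1// lerBrDl ltW.
Qed.

(** The fraction of the height cell of the cut that lies below [y]. Unlike the indicator of the cuts
    below [y], it varies continuously with [y], as a local Lipschitz estimate requires. *)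
Definition cut_weight n X y (w : nat) :=
  clamp (2 ^+ n.+2 * y - (cut_height n X w)%:R).

(** All differences have the same sign, and the heights in a column run through all integers below
    2^(n+2), so that the weights at [y] sum to 2^(n+2) y. *)
Lemma sum_cut_weight_row n X y y' : 0 <= y <= 1 -> 0 <= y' <= 1 ->
  \sum_(w < 2 ^ n.+2) `|cut_weight n X y w - cut_weight n X y' w| =
  2 ^+ n.+2 * `|y - y'|.
Proof.
wlog yy' : y y' / y <= y'.
  move=> h; have [/h//|/ltW yy' y01 y'01] := leP y y'.
  rewrite distrC -h//; under eq_bigr do rewrite distrC.
  by [].
move=> /andP[y0 y1] /andP[y'0 y'1]; have N0 : 0 < 2 ^+ n.+2 :> R by rewrite exprn_gt0.
under eq_bigr => w _.
  rewrite distrC ger0_norm; last by rewrite subr_ge0 le_clamp// lerD2r ler_pM2l.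
  over.
rewrite sumrB distrC ger0_norm ?subr_ge0// mulrBr.
have E u : 0 <= u -> u <= 1 -> \sum_(w < 2 ^ n.+2) cut_weight n X u w = 2 ^+ n.+2 * u.
  move=> u0 u1; rewrite /cut_weight.
  rewrite -(@reindex_inj _ _ _ _ (@cut_ord n X) xpredT
     (fun i : 'I_ _ => clamp (2 ^+ n.+2 * u - i%:R))) //; last exact: cut_ord_inj.
  rewrite sum_clamp; last by rewrite mulr_ge0// ltW.
  by rewrite min_l// natrX ler_piMr// ltW.
by rewrite !E.
Qed.

Lemma xcell_near n x : 0 <= x <= 1 -> exists2 e, 0 < e &
  forall x', 0 <= x' <= 1 -> `|x - x'| < e -> xcell n x' = xcell n x \/
    [/\ (0 < xcell n x)%N, 2 ^+ n.+1 * x = (xcell n x)%:R & xcell n x' = (xcell n x).-1].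
Proof.
move=> /andP[x0 x1]; have N0 : 0 < 2 ^+ n.+1 :> R by rewrite exprn_gt0.
have /andP[] := truncn_itv (mulr_ge0 (ltW N0) x0).
move tE : (Num.truncn _) => t h1 h2.
(* If [x] is the left end of its column, the radius may extend through the column on its left;
   otherwise it stops at the left end. The right end is never reached. *)
pose e : R := if t%:R == 2 ^+ n.+1 * x then 2 ^+ n.+1 * x - (t%:R - 1)
  else 2 ^+ n.+1 * x - t%:R.
pose e' : R := Num.min e (t.+1%:R - 2 ^+ n.+1 * x).
have e'0 : 0 < e'.
  rewrite lt_min subr_gt0 h2 andbT /e; case: ifPn => [/eqP <-|].
    by rewrite opprB addrCA subrr addr0.
  by rewrite subr_gt0 lt_neqAle h1 => ->.
exists (e' / 2 ^+ n.+1); first by rewrite divr_gt0.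
move=> x' /andP[x'0 x'1]; rewrite ltr_pdivlMr// mulrC.
rewrite -[2 ^+ n.+1 in X in X -> _](@ger0_norm R) ?ltW// -normrM mulrBr.
rewrite lt_min !ltr_norml => /andP[/andP[a1 a2] /andP[b1 b2]].
have x'0' : 0 <= 2 ^+ n.+1 * x' by rewrite mulr_ge0// ltW.
have := truncn_itv x'0'; rewrite /xcell tE.
move: (Num.truncn (2 ^+ n.+1 * x')) => t' /andP[h1' h2'].
have t't : (t' <= t)%N.
  by rewrite -ltnS -(ltr_nat R) (le_lt_trans h1')//; lra.
have [eqt|nt] := eqVneq (t%:R : R) (2 ^+ n.+1 * x); last first.
  move: a2; rewrite /e (negbTE nt) => a2; left; congr minn.
  apply/eqP; rewrite eqn_leq t't/= -ltnS -(ltr_nat R).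
  by rewrite (le_lt_trans _ h2')//; lra.
have tN : (t <= 2 ^ n.+1)%N.
  by rewrite -(ler_nat R) natrX eqt ler_piMr// ltW.
move: a2; rewrite /e eqt eqxx -eqt => a2.
have tt' : (t <= t'.+1)%N.
  by rewrite -ltnS -(ltr_nat R) -natr1; lra.
suff : minn t' (2 ^ n.+1).-1 = minn t (2 ^ n.+1).-1 \/
    [/\ (0 < t)%N, minn t (2 ^ n.+1).-1 = t & minn t' (2 ^ n.+1).-1 = t.-1].
  by move=> [->|[t0 ht ->]]; [left|right; rewrite ht].
move: tN t't tt'; clear; move: (2 ^ n.+1)%N => N tN t't tt'.
have [->|t't1] : t' = t \/ t = t'.+1 by lia.
  by left.
(* At [x = 1] the truncation exceeds the last column, and both points fall into that column. *)
have [eN|tN'] := eqVneq t N; first by left; lia.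
by right; split; lia.
Qed.

Lemma slit_set_avoid n m l k (p : R * R) : slit_set n p -> (0 < m <= n)%N ->
  (l < 2 ^ m)%N -> (k < 2 ^ m)%N -> ~ slit m l k p.
Proof.
elim: n => [|n IH]; first by case: m.
move=> [pn h] /andP[m0]; rewrite leq_eqVlt => /predU1P[mn|mn] lm km; last first.
  by apply: IH => //; rewrite m0.
by subst m => plk; apply: h; exists (Ordinal lm) => //; exists (Ordinal km).
Qed.

(** If the exchanged digits differ, both height cells of the cut lie within a single slit of this
    abscissa. The point is not on that slit, so both weights are 0 or both are 1. *)
Lemma cut_weight_cross n X y w : (0 < X)%N -> (w < 2 ^ n.+2)%N ->
  slit_set n (X%:R / 2 ^+ n.+1, y) -> cut_weight n X.-1 y w = cut_weight n X y w.
Proof.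
move=> X0 wN pn; have [d [l Xdl]] := oddS_decomposition X0.
(* For [d >= n] no slit of level at most [n] has this abscissa. *)
have [nd|dn] := leqP n d.
  have Xn : X = (2 ^ n * (2 ^ (d - n) * l.*2.+1))%N.
    by rewrite mulnA -expnD subnKC.
  rewrite /cut_weight /cut_height {1 2}Xn -cut_state_dvdn -?Xn//.
  by rewrite muln_gt0 expn_gt0.
have [m nmd] : exists m, n = (m.+1 + d)%N by exists (n - d.+1)%N; lia.
subst n; have [a [r [b [k [rd h1 h2]]]]] := cut_height_cross m d l w.
rewrite /cut_weight Xdl h1 h2.
have [<-//|bk] := eqVneq b k.
have Dn0 : (0 < 2 ^ d)%N by rewrite expn_gt0.
have D0 : 0 < 2 ^+ d :> R by rewrite exprn_gt0.
have M0 : 0 < 2 ^+ m.+1 :> R by rewrite exprn_gt0.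
have NE : 2 ^+ (m.+1 + d).+2 = 4 * 2 ^+ m.+1 * 2 ^+ d :> R.
  by rewrite -addnS -addnS exprD !exprS; ring.
have am : (a < 2 ^ m.+1)%N.
  have := cut_height_lt (m.+1 + d) (2 ^ d * l.*2.+1)%N w; rewrite h2.
  rewrite (_ : (m.+1 + d).+2 = (2 + m.+1 + d)%N) ?expnD; last by lia.
  move=> h; have : (4 * a * 2 ^ d < 2 ^ 2 * 2 ^ m.+1 * 2 ^ d)%N by lia.
  by rewrite ltn_pmul2r//; lia.
have xE : X%:R / 2 ^+ (m.+1 + d).+1 = (2 * l + 1)%:R / 2 ^+ m.+2 :> R.
  rewrite Xdl natrM natrX -addnS exprD !exprS addn1 mul2n.
  by field; rewrite !expf_neq0.
have lm : (l < 2 ^ m.+1)%N.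
  have [/andP[_ /= + ] _] := slit_set_square pn.
  rewrite xE ler_pdivrMr ?exprn_gt0// mul1r -natrX ler_nat expnS; lia.
have := slit_set_avoid pn (_ : 0 < m.+1 <= m.+1 + d)%N lm am.
rewrite leq_addr => /(_ isT) avoid.
have {avoid} : ~~ (((4 * a + 1)%:R : R) <= 4 * 2 ^+ m.+1 * y <= (4 * a + 3)%:R).
  apply/negP => /andP[y1 y2]; apply: avoid; split => //=.
  have E4 : 2 ^+ m.+3 = 4 * 2 ^+ m.+1 :> R by rewrite !exprS; ring.
  by rewrite E4 ler_pdivrMr ?mulr_gt0// ler_pdivlMr ?mulr_gt0// mulrC y1.
have rd' : (r.+1 <= 2 ^ d)%N by [].
have := rd'; rewrite -(ler_nat R) natrX -natr1 => {}rd'.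
have r0 : (0 : R) <= r%:R by [].
have hE (u v : bool) : ((4 * a + 2 * u + v) * 2 ^ d + r)%:R =
    (4 * a%:R + 2 * u%:R + v%:R) * 2 ^+ d + r%:R :> R.
  by rewrite natrD natrM natrX natrD natrD natrM natrM.
rewrite !hE.
have E1 : (4 * a + 1)%:R = 4 * a%:R + 1 :> R by rewrite natrD natrM.
have E3 : (4 * a + 3)%:R = 4 * a%:R + 3 :> R by rewrite natrD natrM.
rewrite negb_and -!ltNge NE E1 E3 => /orP[yl|yr].
- have yl' : 4 * 2 ^+ m.+1 * 2 ^+ d * y < (4 * a%:R + 1) * 2 ^+ d.
    by rewrite mulrAC ltr_pM2r.
  by rewrite !clamp0// subr_le0; case: b k bk {h1 h2} => [] [] //= _; lra.
- have yr' : (4 * a%:R + 3) * 2 ^+ d < 4 * 2 ^+ m.+1 * 2 ^+ d * y.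
    by rewrite [ltRHS]mulrAC ltr_pM2r.
  by rewrite !clamp1// lerBrDr; case: b k bk {h1 h2} => [] [] //= _; lra.
Qed.

Definition weight_dist n (p q : R * R) :=
  (\sum_(w < 2 ^ n.+2) `|cut_weight n (xcell n p.1) p.2 w -
                         cut_weight n (xcell n q.1) q.2 w|) / 2 ^+ n.+2.

Lemma weight_distxx n p : weight_dist n p p = 0.
Proof.
rewrite /weight_dist; under eq_bigr do rewrite subrr normr0.
by rewrite big1// mul0r.
Qed.

Lemma weight_dist_sym n p q : weight_dist n p q = weight_dist n q p.
Proof. by rewrite /weight_dist; under eq_bigr do rewrite distrC. Qed.

Lemma weight_dist_triangle n q p r :
  weight_dist n p r <= weight_dist n p q + weight_dist n q r.
Proof.
rewrite /weight_dist -mulrDl ler_pM2r ?invr_gt0 ?exprn_gt0// -big_split/=.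
by apply: ler_sum => w _; exact: ler_distD.
Qed.

Lemma ler_dist2_eudist (p q : R * R) : `|p.2 - q.2| <= eudist p q.
Proof.
rewrite -sqrtr_sqr ler_sqrt ?lerDr ?sqr_ge0//.
by rewrite addr_ge0 ?sqr_ge0.
Qed.

(** Since [p] is not on a slit, passing at its height to an adjacent column changes no weight; what
    remains is a vertical move in the column of [q]. *)
Lemma weight_dist_local n p : slit_set n p -> exists2 e, 0 < e &
  forall q, slit_set n q -> `|p.1 - q.1| < e -> weight_dist n p q <= eudist p q.
Proof.
move=> pn; have [x01 y01] := slit_set_square pn.
have [e e0 He] := xcell_near n x01; exists e => // q qn pq.
have [x'01 y'01] := slit_set_square qn.
apply: le_trans (ler_dist2_eudist p q).
rewrite ler_pdivrMr ?exprn_gt0// mulrC -(@sum_cut_weight_row n (xcell n q.1))//.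
apply: ler_sum => w _; have [->//|[X0 xX ->]] := He _ x'01 pq.
rewrite (@cut_weight_cross _ _ p.2)//; rewrite -xX mulrAC mulfV ?expf_neq0// mul1r.
by rewrite -surjective_pairing.
Qed.

Lemma weight_dist_path n p q :
  ((weight_dist n p q)%:E <= path_edist (slit_set n) p q)%E.
Proof.
apply: le_ereal_inf_tmp => _ [f [cf <- <- fA] <-].
apply: locally_dominated_curve_length.
- exact: weight_distxx.
- exact: weight_dist_sym.
- exact: weight_dist_triangle.
move=> t t01; have ft s : 0 <= s <= 1 -> slit_set n (f s).
  by move=> s01; apply: fA; exists s.
have [e e0 He] := weight_dist_local (ft _ t01).
have /subspace_continuousP/(_ t) := cf; rewrite /= in_itv/= => /(_ t01) ctf.
have : \forall s \near within `[0, 1] (nbhs t), `|(f t).1 - (f s).1| < e.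
  have cf1 : (f s).1 @[s --> within `[0, 1] (nbhs t)] --> (f t).1.
    exact: cvg_comp ctf cvg_fst.
  by move/cvgrPdist_lt : cf1; apply.
rewrite near_withinE => /nbhs_ballP[e' /= e'0 He'].
exists e' => // s s01 ts; apply: He; first exact: ft.
by apply: He' => //=; rewrite in_itv.
Qed.

(** Indicator and weight differ only for the cut whose height is exactly [ycell], that is for at
    most one cut at each of the two points. *)
Lemma symdist_le_weight_dist n p q : slit_set n p -> slit_set n q ->
  symdist measure01 (level_set n p) (level_set n q) <=
  weight_dist n p q + 2 / 2 ^+ n.+2.
Proof.
move=> pn qn; have [_ /andP[y0 _]] := slit_set_square pn.
have [_ /andP[y'0 _]] := slit_set_square qn.
rewrite symdist_level_set /weight_dist -mulrDl ler_pM2r ?invr_gt0 ?exprn_gt0//.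
pose I X (Y : nat) (w : 'I_(2 ^ n.+2)) : R := (cut_height n X w == Y)%:R.
have sumI X Y : \sum_w I X Y w <= 1.
  have : (#|[set w : 'I_(2 ^ n.+2) | cut_height n X w == Y]%SET| <= 1)%N.
    apply/card_le1_eqP => w w'; rewrite !inE => /eqP h /eqP h'.
    by apply/val_inj/(@cut_height_inj n X); rewrite ?ltn_ord //=; congruence.
  rewrite -(ler_nat R); apply: le_trans.
  rewrite -sum1_card natr_sum [leRHS]big_mkcond/=; apply: ler_sum => w _.
  by rewrite finset.inE /I; case: eqP.
have bnd X y (w : 'I_(2 ^ n.+2)) : 0 <= y ->
    `|(cut_height n X w < ycell n y)%N%:R - cut_weight n X y w| <= I X (ycell n y) w.
  move=> u0; have /andP[h1 h2] := ycell_itv n u0.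
  rewrite /I /cut_weight; case: ltngtP => [lt|gt|->].
  - rewrite clamp1 ?subrr ?normr0// lerBrDr.
    by apply: le_trans h1; rewrite addrC natr1 ler_nat.
  - rewrite clamp0 ?subrr ?normr0// subr_le0 (le_trans (ltW h2))//.
    by rewrite natr1 ler_nat.
  - by rewrite sub0r normrN ger0_norm; have /andP[] := clamp_itv (2 ^+ n.+2 * y - (ycell n y)%:R).
pose W (w : 'I_(2 ^ n.+2)) : R :=
  `|cut_weight n (xcell n p.1) p.2 w - cut_weight n (xcell n q.1) q.2 w|.
have W2 : \sum_w (W w + (I (xcell n p.1) (ycell n p.2) w +
    I (xcell n q.1) (ycell n q.2) w)) <= \sum_w W w + 2.
  rewrite big_split/= lerD2l big_split/= [leRHS](_ : 2 = 1 + 1)//.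
  by rewrite lerD.
apply: le_trans W2.
rewrite -sum1_card natr_sum [leLHS]big_mkcond/=; apply: ler_sum => w _.
rewrite finset.inE /W.
have := bnd (xcell n p.1) p.2 w y0; have := bnd (xcell n q.1) q.2 w y'0.
move: (cut_weight _ _ _ _) (cut_weight _ _ _ _) (I _ _ _) (I _ _ _) => v u j i.
case: (_ < _)%N; case: (_ < _)%N => /=; rewrite ?mulr0n ?mulr1n !ler_norml => /andP[? ?] /andP[? ?];
  have := ler_norm (v - u); have := ler_norm (u - v); rewrite (distrC u); lra.
Qed.

Lemma symdist_level_set_path n (p q : R * R) : slit_set n p -> slit_set n q ->
  ((symdist measure01 (level_set n p) (level_set n q))%:E <=
    path_edist (slit_set n) p q + (2 / 2 ^+ n.+2)%:E)%E.
Proof.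
move=> pn qn.
apply: (@le_trans _ _ ((weight_dist n p q)%:E + (2 / 2 ^+ n.+2)%:E)%E).
  by rewrite -EFinD lee_fin symdist_le_weight_dist.
by rewrite leeD2r// weight_dist_path.
Qed.

End upper_bound.

(** * The cuts detect the detours around slits *)

Section lower_bound.
Context {R : realType}.
Implicit Types (x y z : R) (p q : R * R) (n k X : nat).

Lemma slit_setP n p : 0 <= p.1 <= 1 -> 0 <= p.2 <= 1 ->
  (forall m l c, (0 < m <= n)%N -> (l < 2 ^ m)%N -> (c < 2 ^ m)%N ->
    ~ slit m l c p) -> slit_set n p.
Proof.
move=> p1 p2; elim: n => [|n IH] h; first by split; rewrite /= in_itv.
split; first by apply: IH => m l c /andP[m0 mn]; apply: h; rewrite m0 (leqW mn).
by move=> [l _ [c _]]; apply: h; rewrite ?ltn_ord ?leqnn.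
Qed.

(** In units of 2^-(m+2) with m > k this height is a multiple of 4, while the slits of level m run
    from 4c+1 to 4c+3. *)
Lemma slit_set_dyadic_height k n x (Z : nat) : (k <= n)%N ->
  slit_set k (x, Z%:R / 2 ^+ k.+1) -> slit_set n (x, Z%:R / 2 ^+ k.+1).
Proof.
move=> kn xk; have [x01 z01] := slit_set_square xk.
apply: slit_setP => // m l c /andP[m0 mn] lm cm.
have [mk|km] := leqP m k; first by apply: slit_set_avoid xk _ lm cm; rewrite m0.
move=> [_ /=].
have [j mE] : exists j, m = (k.+1 + j)%N by exists (m - k.+1)%N; lia.
have -> : 2 ^+ m.+2 = 4 * 2 ^+ j * 2 ^+ k.+1 :> R.
  by rewrite mE -addnS -addnS exprD !exprS; ring.
have J0 : 0 < 2 ^+ j :> R by rewrite exprn_gt0.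
have K0 : 0 < 2 ^+ k.+1 :> R by rewrite exprn_gt0.
rewrite ler_pdivrMr ?mulr_gt0// ler_pdivlMr ?mulr_gt0//.
have -> : Z%:R / 2 ^+ k.+1 * (4 * 2 ^+ j * 2 ^+ k.+1) = Z%:R * (4 * 2 ^+ j) :> R.
  by field; rewrite !expf_neq0.
rewrite -natrX -!natrM !ler_nat; move: (2 ^ j)%N => J; lia.
Qed.

Lemma xcell_itv n x : 0 <= x <= 1 ->
  (xcell n x)%:R <= 2 ^+ n.+1 * x <= (xcell n x)%:R + 1.
Proof.
move=> /andP[x0 x1]; have N0 : 0 < 2 ^+ n.+1 :> R by rewrite exprn_gt0.
have /andP[h1 h2] := truncn_itv (mulr_ge0 (ltW N0) x0).
rewrite /xcell; set t := Num.truncn _ in h1 h2 *.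
have N1 := expn_gt0 2 n.+1.
have [tN|Nt] := ltnP t (2 ^ n.+1).
  by rewrite (minn_idPl _) ?h1 ?natr1 ?(ltW h2)//; lia.
rewrite (minn_idPr _); last by lia.
rewrite natr1 prednK// natrX ler_piMr ?(ltW N0)// andbT (le_trans _ h1)//.
by rewrite ler_nat; lia.
Qed.

Lemma xcell_lt n x : (xcell n x < 2 ^ n.+1)%N.
Proof. by rewrite /xcell; have := expn_gt0 2 n.+1; lia. Qed.

Lemma xcell_level k j x : 0 <= x ->
  (xcell k x * 2 ^ j <= xcell (k + j) x < (xcell k x).+1 * 2 ^ j)%N.
Proof.
move=> x0; elim: j => [|j IH]; first by rewrite addn0 !muln1 leqnn /=.
move: IH; rewrite -(xcell_half (k + j)) // addnS expnS; move: (2 ^ j)%N => J.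
by move: (xcell _ _) (xcell _ _) => u v; nia.
Qed.

Lemma slit_abscissaN n X (t : R) : X%:R < 2 ^+ n.+1 * t < X%:R + 1 ->
  ~ slit_abscissa n t.
Proof.
move=> /andP[h1 h2] /slit_abscissa_int[_ [z]]; rewrite mulrC => tz.
move: h1 h2; rewrite tz natr1 !pmulrn !ltr_int; lia.
Qed.

(** The middle of the column of [x], which is off every slit abscissa up to level [n]. *)
Definition xmid n x : R := ((xcell n x)%:R + 2^-1) / 2 ^+ n.+1.

Lemma xmid_level n k x : 0 <= x -> (k <= n)%N ->
  (xcell k x)%:R < 2 ^+ k.+1 * xmid n x < (xcell k x)%:R + 1.
Proof.
move=> x0 /subnKC; move: (n - k)%N => j <- {n}.
have J0 : 0 < 2 ^+ j :> R by rewrite exprn_gt0.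
have -> : 2 ^+ k.+1 * xmid (k + j) x = ((xcell (k + j) x)%:R + 2^-1) / 2 ^+ j.
  by rewrite /xmid -addSn exprD; field; rewrite !expf_neq0.
have /andP[h1 h2] := xcell_level k j x0.
have {}h1 : (xcell k x)%:R * 2 ^+ j <= (xcell (k + j) x)%:R :> R.
  by rewrite -natrX -natrM ler_nat.
have {}h2 : (xcell (k + j) x)%:R + 1 <= ((xcell k x)%:R + 1) * 2 ^+ j :> R.
  by rewrite !natr1 -natrX -natrM ler_nat.
by rewrite ltr_pdivlMr// ltr_pdivrMr//; apply/andP; split; lra.
Qed.

Lemma xmid_dist n x : 0 <= x <= 1 -> `|x - xmid n x| <= 1 / 2 ^+ n.
Proof.
move=> x01; have /andP[h1 h2] := xcell_itv n x01.
have N0 : 0 < 2 ^+ n :> R by rewrite exprn_gt0.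
rewrite ler_pdivlMr// -[2 ^+ n in leLHS](@ger0_norm R) ?(ltW N0)// -normrM mulrBl.
have -> : xmid n x * 2 ^+ n = ((xcell n x)%:R + 2^-1) / 2.
  by rewrite /xmid exprS; field; rewrite expf_neq0.
by rewrite exprS in h1 h2; rewrite ler_norml; apply/andP; split; lra.
Qed.

Lemma xmid_itv n x : 0 <= x <= 1 -> 0 <= xmid n x <= 1.
Proof.
move=> /andP[x0 _]; have /andP[h1 h2] := xmid_level x0 (leqnn n).
have N0 : 0 < 2 ^+ n.+1 :> R by rewrite exprn_gt0.
apply/andP; split; first by rewrite -(pmulr_rge0 _ N0) (le_trans _ (ltW h1)).
rewrite -(ler_pM2l N0) mulr1; apply: le_trans (ltW h2) _.
by rewrite natr1 -natrX ler_nat; exact: xcell_lt.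
Qed.

Lemma itv01_segment (u v t : R) : 0 <= u <= 1 -> 0 <= v <= 1 -> 0 <= t <= 1 ->
  0 <= u + t * (v - u) <= 1.
Proof.
move=> /andP[u0 u1] /andP[v0 v1] /andP[t0 t1].
have h1 : 0 <= t * v by rewrite mulr_ge0.
have h2 : t * v <= t by rewrite ler_piMr.
have h3 : 0 <= (1 - t) * u by rewrite mulr_ge0// subr_ge0.
have h4 : (1 - t) * u <= 1 - t by rewrite ler_piMr// subr_ge0.
by apply/andP; rewrite (_ : u + _ = (1 - t) * u + t * v); [lra|ring].
Qed.

Lemma path_edist_xmid n x y : slit_set n (x, y) ->
  (path_edist (slit_set n) (x, y) (xmid n x, y) <= (1 / 2 ^+ n)%:E)%E.
Proof.
move=> pn; have [/= x01 y01] := slit_set_square pn.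
apply: (@le_trans _ _ (eudist (x, y) (xmid n x, y))%:E); last first.
  by rewrite lee_fin /eudist/= subrr expr0n addr0 sqrtr_sqr xmid_dist.
apply: path_edist_segment => t; rewrite in_itv/= /segment_path/= => t01.
rewrite subrr mulr0 addr0.
(* Only the starting point can lie on a column boundary, and it avoids the slits by hypothesis. *)
have [->|t0] := eqVneq t 0; first by rewrite mul0r addr0.
have {}t0 : 0 < t by rewrite lt0r t0; case/andP: t01.
apply: slit_setI => //; first exact: itv01_segment x01 (xmid_itv n x01) t01.
left; apply: (@slit_abscissaN n (xcell n x)).
have /andP[h1 h2] := xcell_itv n x01.
have /andP[h3 h4] := xmid_level (proj1 (andP x01)) (leqnn n).
have -> : 2 ^+ n.+1 * (x + t * (xmid n x - x)) =
    2 ^+ n.+1 * x + t * (2 ^+ n.+1 * xmid n x - 2 ^+ n.+1 * x) by ring.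
move: (2 ^+ n.+1 * x) (2 ^+ n.+1 * xmid n x) h1 h2 h3 h4 => u v h1 h2 h3 h4.
move: t01 => /andP[_ t1].
have e1 : 0 < t * (v - (xcell n x)%:R) by rewrite mulr_gt0// subr_gt0.
have e2 : 0 < t * ((xcell n x)%:R + 1 - v) by rewrite mulr_gt0// subr_gt0.
have e3 : 0 <= (1 - t) * (u - (xcell n x)%:R) by rewrite mulr_ge0// subr_ge0.
have e4 : 0 <= (1 - t) * ((xcell n x)%:R + 1 - u) by rewrite mulr_ge0// subr_ge0.
by apply/andP; split; lra.
Qed.

Lemma path_edist_vertical n x y z : 0 <= x <= 1 -> 0 <= y <= 1 -> 0 <= z <= 1 ->
  (path_edist (slit_set n) (xmid n x, y) (xmid n x, z) <= `|y - z|%:E)%E.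
Proof.
move=> x01 y01 z01.
apply: (@le_trans _ _ (eudist (xmid n x, y) (xmid n x, z))%:E); last first.
  by rewrite lee_fin /eudist/= subrr expr0n add0r sqrtr_sqr.
apply: path_edist_segment => t; rewrite in_itv/= /segment_path/= => t01.
rewrite subrr mulr0 addr0; apply: slit_setI; first exact: xmid_itv.
  exact: itv01_segment.
by left; exact/slit_abscissaN/xmid_level/leqnn/(proj1 (andP x01)).
Qed.

(** The path goes to the middle of the column, vertically to height [z], across, and then
    symmetrically to the end. The two end segments cost 1/2^n each, and the horizontal crossing
    exceeds |x - x'| by at most 2/2^n. *)
Lemma path_edist_via n x y x' y' z : slit_set n (x, y) -> slit_set n (x', y') ->
  (forall t, 0 <= t <= 1 ->
    slit_set n (xmid n x + t * (xmid n x' - xmid n x), z)) ->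
  (path_edist (slit_set n) (x, y) (x', y') <=
   (`|x - x'| + `|y - y'| + 2 * `|y - z| + 4 / 2 ^+ n)%:E)%E.
Proof.
move=> pn qn h; have [/= x01 y01] := slit_set_square pn.
have [/= x'01 y'01] := slit_set_square qn.
have t0 : 0 <= (0 : R) <= 1 by rewrite lexx ?ler01.
have [_ /= z01] := slit_set_square (h _ t0).
have hor : (path_edist (slit_set n) (xmid n x, z) (xmid n x', z) <=
    (`|x - x'| + 2 / 2 ^+ n)%:E)%E.
  apply: (@le_trans _ _ (eudist (xmid n x, z) (xmid n x', z))%:E).
    apply: path_edist_segment => t; rewrite in_itv/= /segment_path/= => t01.
    by rewrite subrr mulr0 addr0; exact: h.
  rewrite lee_fin /eudist/= subrr expr0n addr0 sqrtr_sqr.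
  have h1 := xmid_dist n x01; have h2 := xmid_dist n x'01.
  have h3 := ler_normD (xmid n x - x) (x - x' + (x' - xmid n x')).
  have h4 := ler_normD (x - x') (x' - xmid n x').
  rewrite (_ : xmid n x - x + _ = xmid n x - xmid n x') in h3; last by ring.
  rewrite distrC in h1; lra.
have [v1 v2] := (path_edist_vertical n x01 y01 z01, path_edist_vertical n x'01 z01 y'01).
have e1 := path_edist_xmid pn; have := path_edist_xmid qn.
rewrite path_edist_sym => e2.
apply: (@le_trans _ _ ((1 / 2 ^+ n)%:E + (`|y - z|%:E + ((`|x - x'| + 2 / 2 ^+ n)%:E +
    (`|z - y'|%:E + (1 / 2 ^+ n)%:E))))%E).
  apply: le_trans (path_edist_triangle _ (xmid n x, y) _ _) _; apply: leeD => //.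
  apply: le_trans (path_edist_triangle _ (xmid n x, z) _ _) _; apply: leeD => //.
  apply: le_trans (path_edist_triangle _ (xmid n x', z) _ _) _; apply: leeD => //.
  by apply: le_trans (path_edist_triangle _ (xmid n x', y') _ _) _; apply: leeD.
rewrite -!EFinD lee_fin.
have := ler_normD (z - y) (y - y'); rewrite (distrC z y).
by rewrite (_ : z - y + (y - y') = z - y'); [lra|ring].
Qed.

Lemma dyadic_itv01 k (Z : nat) : (Z <= 2 ^ k)%N -> 0 <= (Z%:R / 2 ^+ k : R) <= 1.
Proof.
move=> Zk; rewrite divr_ge0 ?exprn_ge0//= ler_pdivrMr ?exprn_gt0// mul1r.
by rewrite -natrX ler_nat.
Qed.

(** Up to level [k] only the slits of level k - d have this abscissa, and there are some only if
    [d < k]. The condition on [Z] is in units of 2^-(k+2). *)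
Lemma slit_set_dyadic_point k d l Z : (2 ^ d * l.*2.+1 <= 2 ^ k.+1)%N ->
  (Z <= 2 ^ k.+1)%N ->
  ((d < k)%N -> forall c,
    ~~ ((4 * c + 1) * 2 ^ d <= 2 * Z <= (4 * c + 3) * 2 ^ d)%N) ->
  slit_set k ((2 ^ d * l.*2.+1)%:R / 2 ^+ k.+1 : R, Z%:R / 2 ^+ k.+1).
Proof.
move=> Xk Zk h; apply: slit_setP => /=; try exact: dyadic_itv01.
move=> m l' c /andP[m0 mk] lm cm [/= xE].
have [j kE] : exists j, k = (m + j)%N by exists (k - m)%N; rewrite subnKC.
have M0 : 0 < 2 ^+ m :> R by rewrite exprn_gt0.
have J0 : 0 < 2 ^+ j :> R by rewrite exprn_gt0.
have kE1 : 2 ^+ k.+1 = 2 * 2 ^+ m * 2 ^+ j :> R.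
  by rewrite kE -addSn exprD exprS.
have [dj ll] : d = j /\ l = l'.
  apply: oddS_decomposition_inj; apply/eqP; rewrite -(eqr_nat R).
  move/eqP: xE; rewrite kE1 exprS eqr_div ?mulf_neq0 ?expf_neq0//.
  rewrite (_ : _ * (2 * 2 ^+ m) = (2 ^ d * l.*2.+1)%:R * (2 * 2 ^+ m)) //.
  rewrite (_ : _ * (2 * _ * _) = (2 ^ j * l'.*2.+1)%:R * (2 * 2 ^+ m)); last first.
    by rewrite natrM natrX addn1 mul2n; ring.
  by move/eqP/mulIf => -> //; rewrite mulf_neq0 ?expf_neq0.
subst j l'; have dk : (d < k)%N by lia.
rewrite kE1 (_ : 2 ^+ m.+2 = 4 * 2 ^+ m :> R); last by rewrite !exprS; ring.
rewrite ler_pdivrMr ?mulr_gt0// ler_pdivlMr ?mulr_gt0//.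
rewrite (_ : Z%:R / _ * _ = (2 * Z)%:R / 2 ^+ d); last first.
  by rewrite natrM; field; rewrite !expf_neq0.
rewrite ler_pdivlMr// ler_pdivrMr// -natrX -!natrM !ler_nat.
exact/negP/(h dk).
Qed.

(** If a slit blocks the even height next to [y], its nearer end is no farther, up to rounding, than
    the number of cuts that jump across [y]. The 4 is the rounding error 3 of the even height plus 1
    for replacing [y] by its cell. *)
Lemma crossing_height k X y : (X.+1 < 2 ^ k.+1)%N -> 0 <= y <= 1 ->
  exists Z : nat, slit_set k (X.+1%:R / 2 ^+ k.+1 : R, Z%:R / 2 ^+ k.+1) /\
    `|y - Z%:R / 2 ^+ k.+1| <=
      (4 + #|cut_diff k X (ycell k y) X.+1 (ycell k y)|%:R) / 2 ^+ k.+2.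
Proof.
move=> Xk /andP[y0 y1]; set m := #|_|.
have N0 : 0 < 2 ^+ k.+2 :> R by rewrite exprn_gt0.
have /andP[h1 h2] := ycell_itv k y0; have Yk := ycell_le k y1.
move: (ycell k y) @m h1 h2 Yk => Y m h1 h2 Yk.
suff [Z [Zk1 Zk2 Zk3]] : exists Z, [/\
    slit_set k (X.+1%:R / 2 ^+ k.+1 : R, Z%:R / 2 ^+ k.+1),
    (Y <= 2 * Z + m + 3)%N & (2 * Z <= Y + m + 3)%N].
  exists Z; split => //.
  rewrite ler_pdivlMr// -[2 ^+ k.+2 in leLHS](@ger0_norm R) ?(ltW N0)// -normrM.
  rewrite (_ : _ * 2 ^+ k.+2 = 2 ^+ k.+2 * y - 2 * Z%:R); last first.
    by rewrite !exprS; field; rewrite expf_neq0.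
  have e2 : Y%:R <= 2 * Z%:R + m%:R + 3 :> R by rewrite -natrM -!natrD ler_nat.
  have e3 : 2 * Z%:R <= Y%:R + m%:R + 3 :> R by rewrite -natrM -!natrD ler_nat.
  by rewrite ler_norml; apply/andP; split; lra.
have [d [l Xdl]] := oddS_decomposition (ltn0Sn X).
have Z0k : (Y./2 <= 2 ^ k.+1)%N by move: Yk; rewrite [(2 ^ k.+2)%N]expnS; lia.
have Xdl' : (2 ^ d * l.*2.+1 <= 2 ^ k.+1)%N by rewrite -Xdl ltnW.
have [[dk [c bad]]|good] := pselect ((d < k)%N /\ exists c,
    ((4 * c + 1) * 2 ^ d <= 2 * Y./2 <= (4 * c + 3) * 2 ^ d)%N); last first.
  exists Y./2; split; [|by lia|by lia].
  rewrite Xdl; apply: slit_set_dyadic_point => // dk c; apply/negP => h.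
  by apply: good; split => //; exists c.
have [m' kE] : exists m', k = (m'.+1 + d)%N by exists (k - d.+1)%N; lia.
have D0 : (0 < 2 ^ d)%N by rewrite expn_gt0.
have kE2 : (2 ^ k.+1 = 2 * 2 ^ m'.+1 * 2 ^ d)%N.
  by rewrite kE -addSn expnD [in LHS]expnS.
have cm : (c < 2 ^ m'.+1)%N.
  move: bad Z0k; rewrite kE2; move: (2 ^ d)%N D0 (2 ^ m'.+1)%N => D D0 M bad Z0k.
  have : ((4 * c + 1) * D <= 4 * M * D)%N by lia.
  by rewrite leq_pmul2r//; lia.
(* [Y] may exceed [2 * Y./2] by one, whence the [+ 1]. *)
have Yc : ((4 * c + 1) * 2 ^ d <= Y <= (4 * c + 3) * 2 ^ d + 1)%N.
  by move: bad; clear; move: (2 ^ d)%N => D; lia.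
have [Z Zgood [Zk Zk1 Zk2]] := even_below_above_slit D0 Yc.
have := card_cut_diff_cross d l Y cm; rewrite -kE -Xdl /= -/m => minm.
exists Z; split; [|by lia|by lia].
rewrite Xdl; apply: slit_set_dyadic_point => //.
rewrite kE2; move: Zk; move: (2 ^ d)%N (2 ^ m'.+1)%N cm => D M cm Zk.
have : ((4 * c + 4) * D <= 4 * M * D)%N by rewrite leq_mul2r; lia.
by lia.
Qed.

(** The height avoids all levels above [k]. Up to level [k] the segment can meet a slit only at the
    boundary between the two columns, where the crossing point is assumed to be free. *)
Lemma xmid_segment_slit_set k n x x' (Z : nat) (t : R) : (k <= n)%N ->
  0 <= x <= 1 -> 0 <= x' <= 1 -> (Z <= 2 ^ k.+1)%N -> 0 <= t <= 1 ->
  xcell k x' = xcell k x \/ xcell k x' = (xcell k x).+1 /\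
    slit_set k ((xcell k x).+1%:R / 2 ^+ k.+1 : R, Z%:R / 2 ^+ k.+1) ->
  slit_set n (xmid n x + t * (xmid n x' - xmid n x), Z%:R / 2 ^+ k.+1).
Proof.
move=> kn x01 x'01 Zk t01 hx; apply: slit_set_dyadic_height => //.
have K0 : 0 < 2 ^+ k.+1 :> R by rewrite exprn_gt0.
have s01 := itv01_segment (xmid_itv n x01) (xmid_itv n x'01) t01.
have /andP[u1 u2] := xmid_level (proj1 (andP x01)) kn.
have /andP[v1 v2] := xmid_level (proj1 (andP x'01)) kn.
have sE : 2 ^+ k.+1 * (xmid n x + t * (xmid n x' - xmid n x)) =
  2 ^+ k.+1 * xmid n x + t * (2 ^+ k.+1 * xmid n x' - 2 ^+ k.+1 * xmid n x) by ring.
set s := _ + _ in s01 sE *; clearbody s.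
move: (2 ^+ k.+1 * xmid n x) (2 ^+ k.+1 * xmid n x') u1 u2 v1 v2 sE.
move=> u v u1 u2 v1 v2 sE; have /andP[t0 t1] := t01.
have conv (a b : R) : a < u -> a < v -> u < b -> v < b -> a < u + t * (v - u) < b.
  move=> au av ub vb.
  have [->|tn0] := eqVneq t 0; first by rewrite mul0r addr0 au.
  have {}t0 : 0 < t by rewrite lt0r tn0.
  have e1 : 0 < t * (v - a) by rewrite mulr_gt0// subr_gt0.
  have e2 : 0 < t * (b - v) by rewrite mulr_gt0// subr_gt0.
  have e3 : 0 <= (1 - t) * (u - a) by rewrite mulr_ge0// ?subr_ge0// ltW.
  have e4 : 0 <= (1 - t) * (b - u) by rewrite mulr_ge0// ?subr_ge0// ltW.
  by apply/andP; split; lra.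
have free (X : nat) : X%:R < 2 ^+ k.+1 * s < X%:R + 1 -> slit_set k (s, Z%:R / 2 ^+ k.+1).
  by move=> h; apply: slit_setI => //; [exact: dyadic_itv01|left; exact: slit_abscissaN h].
case: hx => [xx|[xx tz]]; rewrite xx in v1 v2.
  by apply: (free (xcell k x)); rewrite sE; exact: conv.
rewrite -natr1 in v1 v2.
have /andP[s1 s2] : (xcell k x)%:R < 2 ^+ k.+1 * s < (xcell k x)%:R + 1 + 1.
  by rewrite sE; apply: conv => //; lra.
have [lt|gt|eq] := ltgtP (2 ^+ k.+1 * s) ((xcell k x)%:R + 1).
- by apply: (free (xcell k x)); rewrite s1.
- by apply: (free (xcell k x).+1); rewrite -natr1 gt.
- rewrite (_ : s = (xcell k x).+1%:R / 2 ^+ k.+1)// -natr1 -eq.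
  by field; rewrite gt_eqF.
Qed.

Lemma xcell_adjacent k x x' : 0 <= x <= x' -> x' <= 1 ->
  x' - x < 1 / 2 ^+ k.+1 -> xcell k x' = xcell k x \/ xcell k x' = (xcell k x).+1.
Proof.
move=> /andP[x0 xx'] x'1; have K0 : 0 < 2 ^+ k.+1 :> R by rewrite exprn_gt0.
rewrite ltr_pdivlMr// mulrC mulrBr => h.
have /andP[h1 h2] := truncn_itv (mulr_ge0 (ltW K0) x0).
have /andP[h3 h4] := truncn_itv (mulr_ge0 (ltW K0) (le_trans x0 xx')).
rewrite /xcell.
have := le_truncn (ler_wpM2l (ltW K0) xx').
move: (Num.truncn (2 ^+ k.+1 * x)) (Num.truncn (2 ^+ k.+1 * x')) h1 h2 h3 h4 => a b h1 h2 h3 h4 ab.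
have ba : (b < a.+2)%N.
  by rewrite -(ltr_nat R) (le_lt_trans h3)// -natr1; lra.
by move: ab ba; clear; move: (2 ^ k.+1)%N => N; lia.
Qed.

Lemma symdist_level_set_vertical n x y y' : 0 <= y <= 1 -> 0 <= y' <= 1 ->
  symdist measure01 (level_set n (x, y)) (level_set n (x, y')) <=
  `|y - y'| + 1 / 2 ^+ n.+2.
Proof.
wlog yy' : y y' / y <= y'.
  move=> wl; have [/wl//|/ltW/wl h y01 y'01] := leP y y'.
  by rewrite symdistC distrC; exact: h.
move=> /andP[y0 y1] /andP[y'0 y'1].
have N0 : 0 < 2 ^+ n.+2 :> R by rewrite exprn_gt0.
have Yn : (ycell n y <= ycell n y')%N by rewrite le_truncn// ler_pM2l.
rewrite symdist_level_set /= card_cut_diff_row ?ycell_le// natrB//.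
have /andP[h1 h2] := ycell_itv n y0; have /andP[h3 h4] := ycell_itv n y'0.
rewrite ler_pdivrMr// mulrDl divfK ?gt_eqF// distrC ger0_norm ?subr_ge0//; lra.
Qed.

Lemma path_edist_level k n p q : (k <= n)%N -> slit_set n p -> slit_set n q ->
  `|p.1 - q.1| < 1 / 2 ^+ k.+1 -> `|p.2 - q.2| < 1 / 2 ^+ k.+1 ->
  (path_edist (slit_set n) p q <= (`|p.1 - q.1| + 3 * `|p.2 - q.2| + 11 / 2 ^+ k +
     2 * symdist measure01 (level_set n p) (level_set n q))%:E)%E.
Proof.
move: p q => [x y] [x' y'] /= kn.
wlog xx' : x y x' y' / x <= x'.
  move=> wl pn qn; have [xx'|/ltW x'x] := leP x x'; first exact: wl.
  rewrite (distrC x) (distrC y) path_edist_sym symdistC; exact: wl.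
move=> pn qn dx dy; have [/= x01 y01] := slit_set_square pn.
have [/= x'01 y'01] := slit_set_square qn.
have K0 : 0 < 2 ^+ k :> R by rewrite exprn_gt0.
have N0 : 0 < 2 ^+ n :> R by rewrite exprn_gt0.
have nk : 1 / 2 ^+ n <= 1 / 2 ^+ k :> R.
  by rewrite !div1r lef_pV2// ler_weXn2l// ler1n.
set D := symdist _ _ _.
have D0 : 0 <= D by exact: symdist_ge0.
(* With this crossing height the path of [path_edist_via] has error 2 * (7/2) + 4 = 11 in units of
   1/2^k. *)
suff [Z [Zk hx hz]] : exists Z, [/\ (Z <= 2 ^ k.+1)%N,
    xcell k x' = xcell k x \/ xcell k x' = (xcell k x).+1 /\
      slit_set k ((xcell k x).+1%:R / 2 ^+ k.+1 : R, Z%:R / 2 ^+ k.+1) &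
    `|y - Z%:R / 2 ^+ k.+1| <= (7 / 2) / 2 ^+ k + D + `|y - y'|].
  apply: le_trans (path_edist_via pn qn _) _.
    by move=> t t01; exact: xmid_segment_slit_set hx.
  rewrite lee_fin; lra.
have [/andP[x0 _] /andP[_ x'1] /andP[y0 y1] /andP[y'0 _]] :
  [/\ 0 <= x <= 1, 0 <= x' <= 1, 0 <= y <= 1 & 0 <= y' <= 1] by split.
have := @xcell_adjacent k x x'; rewrite x0 xx' x'1 -[x' - x]ger0_norm ?subr_ge0//.
rewrite distrC dx => /(_ isT isT isT) [xe|xs].
- exists (ycell k y)./2; split; [|by left|].
    have := ycell_le k y1; rewrite [(2 ^ k.+2)%N]expnS.
    by move: (ycell k y) (2 ^ k.+1)%N; clear => Y M; lia.
  have /andP[h1 h2] := ycell_itv k y0.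
  have hY : (ycell k y)%:R = (odd (ycell k y))%:R + (ycell k y)./2%:R * 2 :> R.
    by rewrite -[in LHS](odd_double_half (ycell k y)) -muln2 natrD natrM.
  have b0 : (0 : R) <= (odd (ycell k y))%:R by [].
  have b1 : (odd (ycell k y))%:R <= (1 : R) by case: odd; rewrite ?lexx ?ler01.
  apply: (@le_trans _ _ ((7 / 2) / 2 ^+ k)); last first.
    by rewrite -addrA lerDl addr_ge0.
  rewrite ler_pdivlMr// -[2 ^+ k in leLHS](@ger0_norm R) ?(ltW K0)// -normrM.
  rewrite (_ : _ * 2 ^+ k = 2 ^+ k.+2 * y / 4 - (ycell k y)./2%:R / 2); last first.
    by rewrite !exprS; field; rewrite expf_neq0.
  rewrite ler_norml; apply/andP; split; lra.
- have Xk : ((xcell k x).+1 < 2 ^ k.+1)%N by rewrite -xs; exact: xcell_lt.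
  have [Z [tz hz]] := crossing_height Xk y01.
  exists Z; split; [|by right|].
    have [_ /= /andP[_]] := slit_set_square tz.
    by rewrite ler_pdivrMr ?exprn_gt0// mul1r -natrX ler_nat.
  apply: le_trans hz _.
  have mL m p := @measurable_level_set R m p.
  have e1 : #|cut_diff k (xcell k x) (ycell k y) (xcell k x).+1 (ycell k y)|%:R / 2 ^+ k.+2 =
      symdist measure01 (level_set k (x, y)) (level_set k (x', y)) :> R.
    by rewrite symdist_level_set /= xs.
  have e2 : symdist measure01 (level_set k (x', y')) (level_set k (x', y)) <=
      `|y - y'| + 1 / 2 ^+ k.+2.
    by rewrite (distrC y); exact: symdist_level_set_vertical.
  (* In units of 1/2^k the errors are 1 from [crossing_height], 1/4 from moving [y] to [y'], and 1
     at each point from passing between levels [k] and [n]: in all 13/4, below 7/2. *)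
  have t1 := symdist_triangle measure01T (mL k (x, y)) (mL k (x', y')) (mL k (x', y)).
  have t2 := symdist_triangle measure01T (mL k (x, y)) (mL n (x, y)) (mL k (x', y')).
  have t3 := symdist_triangle measure01T (mL n (x, y)) (mL n (x', y')) (mL k (x', y')).
  have t4 := @symdist_level_set_le R (n - k) k (x, y) x0 y0.
  have t5 := @symdist_level_set_le R (n - k) k (x', y') (le_trans x0 xx') y'0.
  rewrite symdistC in t5; rewrite subnKC// in t4 t5.
  rewrite mulrDl e1; rewrite -/D in t3.
  have e4 : 4 / 2 ^+ k.+2 = 1 / 2 ^+ k :> R by rewrite !exprS; field; rewrite expf_neq0.
  have e5 : 1 / 2 ^+ k.+2 = (1 / 4) / 2 ^+ k :> R by rewrite !exprS; field; rewrite expf_neq0.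
  rewrite e5 in e2; rewrite e4; have := invr_gt0 (2 ^+ k : R); rewrite K0; lra.
Qed.

End lower_bound.

(** * Passage to the limit *)

Section geometric_errors.
Context {R : realType}.

Lemma le_add_geometric (a b c : R) : (forall n, a <= b + c / 2 ^+ n) -> a <= b.
Proof.
move=> h; have cv : b + c / 2 ^+ n @[n --> \oo] --> b + 0.
  apply: cvgD; first exact: cvg_cst.
  rewrite (_ : (fun n => _) = geometric c 2^-1).
    by apply: cvg_geometric; rewrite ger0_norm// invf_lt1// ltr1n.
  by apply/funext => n /=; rewrite exprVn.
rewrite addr0 in cv; apply: (ler_cvg_to (cvg_cst a) cv).
exact: nearW.
Qed.

Lemma geometric_cauchy (u : nat -> R) (c : R) : 0 <= c ->
  (forall n, `|u n - u n.+1| <= c / 2 ^+ n) ->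
  exists l, forall n, `|u n - l| <= 2 * c / 2 ^+ n.
Proof.
move=> c0 h.
have pos n : 0 <= 2 * c / 2 ^+ n by rewrite divr_ge0 ?mulr_ge0// exprn_ge0.
have tele n k : `|u n - u (n + k)%N| <= 2 * c / 2 ^+ n - 2 * c / 2 ^+ (n + k).
  elim: k => [|k IH]; first by rewrite addn0 !subrr normr0.
  have := ler_normD (u n - u (n + k)%N) (u (n + k)%N - u (n + k.+1)%N).
  have := h (n + k)%N; rewrite addrA subrK -addnS.
  rewrite (_ : 2 * c / 2 ^+ (n + k.+1) = c / 2 ^+ (n + k)); last first.
    by rewrite addnS exprS; field; rewrite expf_neq0.
  rewrite (_ : 2 * c / 2 ^+ (n + k) = c / 2 ^+ (n + k) + c / 2 ^+ (n + k)) in IH.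
    by lra.
  by rewrite -mulrA mulr2n mulrDl mul1r.
have bnd n m : u n - 2 * c / 2 ^+ n <= u m + 2 * c / 2 ^+ m.
  have [nm|/ltnW mn] := leqP n m.
    have := tele n (m - n)%N; rewrite subnKC// ler_norml => /andP[h1 h2].
    have := pos m; lra.
  have := tele m (n - m)%N; rewrite subnKC// ler_norml => /andP[h1 h2].
  have := pos n; lra.
exists (sup (range (fun n => u n - 2 * c / 2 ^+ n))) => n.
have h1 : u n - 2 * c / 2 ^+ n <= sup (range (fun n => u n - 2 * c / 2 ^+ n)).
  apply: ub_le_sup; last by exists n.
  by exists (u 0 + 2 * c / 2 ^+ 0) => _ [m _ <-]; exact: bnd.
have h2 : sup (range (fun n => u n - 2 * c / 2 ^+ n)) <= u n + 2 * c / 2 ^+ n.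
  apply: ge_sup; first by exists (u 0 - 2 * c / 2 ^+ 0); exists 0.
  by move=> _ [m _ <-]; exact: bnd.
by rewrite ler_norml; apply/andP; split; lra.
Qed.

Lemma ler_geometric (c : R) n m : 0 <= c -> (n <= m)%N -> c / 2 ^+ m <= c / 2 ^+ n.
Proof.
move=> c0 nm; apply: ler_wpM2l => //.
by rewrite lef_pV2 ?posrE ?exprn_gt0// ler_weXn2l// ler1n.
Qed.

End geometric_errors.

(** * Two-sided estimates on M_n with geometric errors *)

Section slit_domain_estimates.
Context {R : realType}.
Implicit Types (n k : nat) (p q : R * R).

(** [k] is the finest level up to [n] whose scale still exceeds [t]: either it is [n], or [t] is at
    least 1/2^(k+2). *)
Lemma exists_level n (t : R) : 0 <= t < 1 / 2 -> exists k,
  [/\ (k <= n)%N, t < 1 / 2 ^+ k.+1 & 1 / 2 ^+ k <= 4 * t + 1 / 2 ^+ n].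
Proof.
move=> /andP[t0 t1].
suff [k [kn tk]] : exists k, [/\ (k <= n)%N, t < 1 / 2 ^+ k.+1 &
    k = n \/ 1 / 2 ^+ k.+2 <= t].
  have N0 : 0 < 1 / 2 ^+ n :> R by rewrite div1r invr_gt0 exprn_gt0.
  case=> [kE|h]; exists k; split => //; first by rewrite kE lerDr mulr_ge0.
  have : 1 / 2 ^+ k = 4 * (1 / 2 ^+ k.+2) :> R.
    by rewrite !exprS; field; rewrite expf_neq0.
  lra.
elim: n => [|n [k [kn tk h]]].
  by exists 0; split => //; left.
have [tn|tn] := ltP t (1 / 2 ^+ n.+2).
  by exists n.+1; split => //; left.
exists k; split => //; first exact: leqW.
by right; case: h => [->|].
Qed.

Lemma ler_dist1_eudist p q : `|p.1 - q.1| <= eudist p q.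
Proof.
rewrite -sqrtr_sqr ler_sqrt ?lerDl ?sqr_ge0//.
by rewrite addr_ge0 ?sqr_ge0.
Qed.

Lemma ler_dist2_symdist n p q : slit_set n p -> slit_set n q ->
  `|p.2 - q.2| <= symdist measure01 (level_set n p) (level_set n q) + 1 / 2 ^+ n.
Proof.
have N0 : 0 < 2 ^+ n.+2 :> R by rewrite exprn_gt0.
wlog pq : p q / q.2 <= p.2.
  move=> wl pn qn; have [h|/ltW h] := leP q.2 p.2; first exact: wl.
  by rewrite symdistC distrC; exact: wl.
move=> /slit_set_square[_ /andP[y0 y1]] /slit_set_square[_ /andP[y'0 y'1]].
have := @card_cut_diff_ge n (xcell n p.1) _ (xcell n q.1) _ (ycell_le n y1) (ycell_le n y'1).
rewrite -(ler_nat R) natrB; last by rewrite le_truncn// ler_pM2l.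
have /andP[h1 h2] := ycell_itv n y0; have /andP[h3 h4] := ycell_itv n y'0.
rewrite symdist_level_set; move: (#|_|%:R) => c hc.
rewrite (_ : 1 / 2 ^+ n = 4 / 2 ^+ n.+2 :> R); last first.
  by rewrite !exprS; field; rewrite expf_neq0.
rewrite -mulrDl ler_pdivlMr// ger0_norm ?subr_ge0//; lra.
Qed.

(** The level [k] is chosen so that 11/2^k is at most 44 times the sum of the coordinate distances
    plus 11/2^n, and the vertical distance is at most [D + 1 / 2 ^ n]. For points far apart the
    diameter bound 5 suffices. *)
Lemma path_edist_le_symdist n p q : slit_set n p -> slit_set n q ->
  (path_edist (slit_set n) p q <= (47 * `|p.1 - q.1| +
     50 * symdist measure01 (level_set n p) (level_set n q) + 60 / 2 ^+ n)%:E)%E.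
Proof.
move=> pn qn; have hy := ler_dist2_symdist pn qn.
set D := symdist _ _ _ in hy *.
have N0 : 0 < 1 / 2 ^+ n :> R by rewrite div1r invr_gt0 exprn_gt0.
have [a0 b0] := (normr_ge0 (p.1 - q.1), normr_ge0 (p.2 - q.2)).
have D0 : 0 <= D by exact: symdist_ge0.
have [t2|t2] := ltP (`|p.1 - q.1| + `|p.2 - q.2|) (1 / 2); last first.
  by apply: le_trans (slit_path_bound pn qn) _; rewrite lee_fin; lra.
have [k [kn tk hk]] := exists_level n (introT andP (conj (addr_ge0 a0 b0) t2)).
apply: le_trans (path_edist_level kn pn qn _ _) _; [lra|lra|].
rewrite lee_fin -/D; lra.
Qed.

Lemma slit_domain_dist1 n (x y : slit_domain R n) :
  `|(val x).1 - (val y).1| <= mdist x y.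
Proof.
apply: le_trans (ler_dist1_eudist _ _) _.
by rewrite -lee_fin [leRHS]slit_dist_fineK path_edist_ge.
Qed.

Lemma slit_domain_symdist_le n (x y : slit_domain R n) :
  symdist measure01 (level_set n (val x)) (level_set n (val y)) <=
  mdist x y + 1 / 2 ^+ n.
Proof.
rewrite -lee_fin EFinD [X in (X + _)%E]slit_dist_fineK.
apply: le_trans (symdist_level_set_path (slit_domainP x) (slit_domainP y)) _.
rewrite leeD2l// lee_fin !exprS invfM.
have : 0 < (2 ^+ n)^-1 :> R by rewrite invr_gt0 exprn_gt0.
rewrite invfM; lra.
Qed.

Lemma slit_domain_le_symdist n (x y : slit_domain R n) :
  mdist x y <= 47 * `|(val x).1 - (val y).1| +
    50 * symdist measure01 (level_set n (val x)) (level_set n (val y)) + 60 / 2 ^+ n.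
Proof.
rewrite -lee_fin [leLHS]slit_dist_fineK.
by apply: path_edist_le_symdist; exact: slit_domainP.
Qed.

End slit_domain_estimates.

(** * The isometric dense inclusion of a space into its completion *)

Section completion_inclusion.
Context {R : realType}.

Section inclusion.
Variable X : metricType R.

Lemma cauchy_cst (x : X) : cauchy ((fun _ : nat => x) @ \oo).
Proof.
apply/cauchy_mdistP => e e0; exists (setT, setT); first by split; exact: filterT.
by move=> [m n] _ /=; rewrite mdistxx.
Qed.

Definition cst_seq (x : X) : cauchy_seq X := 
  exist _ (fun _ => x) (mem_set (cauchy_cst x)).

Definition to_completion (x : X) : completion X := \pi_(completion X)%qT (cst_seq x).

Lemma to_completion_dist x y : mdist (to_completion x) (to_completion y) = mdist x y.
Proof.
have h := completion_dist_pi (cst_seq x) (cst_seq y).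
rewrite /= in h; have h' : mdist x y @[k --> \oo] --> mdist x y by exact: cvg_cst.
exact: (cvg_unique (@Rhausdorff R) h h').
Qed.

Lemma to_completion_dense (P : completion X) (e : R) : 0 < e ->
  exists x, mdist (to_completion x) P <= e.
Proof.
move=> e0; have /cauchy_mdistP/(_ _ e0) := cauchy_seqP (repr P).
move=> [[A B] /= [fA fB] AB].
have [m Am] := filter_ex fA.
exists (val (repr P) m).
have := completion_dist_pi (cst_seq (val (repr P) m)) (repr P).
rewrite reprK => h; apply: (cvgr_to_le h).
by apply: filterS fB => k Bk; apply/ltW/(AB (m, k)).
Qed.
End inclusion.

Lemma completion_lift_to_completion (X Y : metricType R) (f : X -> Y)
    (f1 : forall x y, mdist (f x) (f y) <= mdist x y) (x : X) :
  completion_lift f1 (to_completion x) = to_completion (f x).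
Proof.
rewrite /to_completion completion_lift_pi; congr (\pi_(completion Y)%qT _).
exact: val_inj.
Qed.

End completion_inclusion.

(** * Limits of the cuts along points of the carpet *)

Section carpet_embedding.
Context {R : realType}.
Implicit Types P Q : slit_carpet R.

(* The two sides of a slit have the same planar coordinates, so B and X cannot be
   read off these: they are limits along points q n of M_n close to P. *)
Definition carpet_code P (q : forall n, slit_domain R n) (B : set R) (X : R) :=
  forall n, [/\ mdist (to_completion (q n)) (val P n) <= 1 / 2 ^+ n,
    symdist measure01 (level_set n (val (q n))) B <= 8 / 2 ^+ n &
    `|(val (q n)).1 - X| <= 4 / 2 ^+ n].

Lemma exists_carpet_code P : exists q B X, measurable B /\ carpet_code P q B X.
Proof.
have e0 n : 0 < 1 / 2 ^+ n :> R by rewrite div1r invr_gt0 exprn_gt0.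
pose q n : slit_domain R n := sval (cid (to_completion_dense (val P n) (e0 n))).
have qP n : mdist (to_completion (q n)) (val P n) <= 1 / 2 ^+ n.
  by rewrite /q; case: cid.
clearbody q.
have half n : 1 / 2 ^+ n.+1 = (1 / 2) / 2 ^+ n :> R.
  by rewrite !exprS; field; rewrite expf_neq0.
have step n : mdist (q n) (slit_incl (q n.+1)) <= 2 / 2 ^+ n.
  rewrite -to_completion_dist.
  have PQ : mdist (val P n) (to_completion (slit_incl (q n.+1))) <= (1 / 2) / 2 ^+ n.
    rewrite -[val P n]slit_carpetP -(completion_lift_to_completion (@slit_incl_lip1 R n)).
    rewrite -half; apply: le_trans (qP n.+1).
    by rewrite metric_sym; exact: slit_proj_lip1.
  apply: le_trans (metric_triangle _ (val P n) _) _.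
  apply: le_trans (lerD (qP n) PQ) _.
  by clear PQ; have := e0 n; lra.
have mL m p := @measurable_level_set R m p.
(* The constant 4 bounds 2 + 1 + 1/2: the distance from [q n] to [q n.+1] in M_n, the error of the
   Lipschitz bound, and the change of level. *)
have [] := @symdist_liminf _ _ R measure01 measure01T
  (fun n => level_set n (val (q n))) 4 (fun n => mL n _).
  move=> n /=.
  have h1 : symdist measure01 (level_set n (val (q n))) (level_set n (val (q n.+1))) <=
      2 / 2 ^+ n + 1 / 2 ^+ n.
    apply: le_trans (slit_domain_symdist_le (q n) (slit_incl (q n.+1))) _.
    by rewrite lerD2r.
  have [/andP[x0 _] /andP[y0 _]] := slit_set_square (slit_domainP (q n.+1)).
  have h2 := symdist_level_setS n x0 y0.
  apply: le_trans (symdist_triangle measure01T (mL n (val (q n)))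
    (mL n (val (q n.+1))) (mL n.+1 (val (q n.+1)))) _.
  apply: le_trans (lerD h1 h2) _.
  by clear h1 h2 x0 y0; have := e0 n; lra.
move=> B mB hB.
have [X hX] := @geometric_cauchy R (fun n => (val (q n)).1) 2 (ler0n _ _)
  (fun n => le_trans (slit_domain_dist1 (q n) (slit_incl (q n.+1))) (step n)).
exists q, B, X; split => // n; split; first exact: qP.
  by have := hB n; rewrite -natrM.
by have := hX n; rewrite -natrM.
Qed.

Section comparison.
Variables (P Q : slit_carpet R) (p q : forall n, slit_domain R n).
Variables (A B : set R) (x y : R).
Hypotheses (mA : measurable A) (mB : measurable B).
Hypotheses (Pp : carpet_code P p A x) (Qq : carpet_code Q q B y).

Let e0 n : 0 < 1 / 2 ^+ n :> R.
Proof. by rewrite div1r invr_gt0 exprn_gt0. Qed.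

Let level_le n : mdist (val P n) (val Q n) <= mdist P Q.
Proof.
apply: (nondecreasing_cvgn_le (nondecreasing_carpet_dist P Q)).
by apply/cvg_ex; exists (carpet_dist P Q); exact: cvg_carpet_dist.
Qed.

Let approx n : `|mdist (p n) (q n) - mdist (val P n) (val Q n)| <= 2 / 2 ^+ n.
Proof.
rewrite -to_completion_dist; apply: le_trans (mdist_lip _ _ _ _) _.
have [h1 _ _] := Pp n; have [h2 _ _] := Qq n.
apply: le_trans (lerD h1 h2) _; clear h1 h2; have := e0 n; lra.
Qed.

Let sym_approx n : `|symdist measure01 A B -
  symdist measure01 (level_set n (val (p n))) (level_set n (val (q n)))| <= 16 / 2 ^+ n.
Proof.
have [_ + _] := Pp n; have [_ + _] := Qq n.
have := @measurable_level_set R n (val (p n)).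
have := @measurable_level_set R n (val (q n)).
move: (level_set _ _) (level_set _ _) => C D mD mC hD hC.
have sC (U V : set R) : symdist measure01 U V = symdist measure01 V U by exact: symdistC.
have t1 : symdist measure01 A B <= symdist measure01 C A + symdist measure01 C B.
  by rewrite (sC C A); exact: (symdist_triangle measure01T mA mC mB).
have t2 : symdist measure01 C B <= symdist measure01 C D + symdist measure01 D B.
  exact: (symdist_triangle measure01T mC mD mB).
have t3 : symdist measure01 C D <= symdist measure01 C A + symdist measure01 A D.
  exact: (symdist_triangle measure01T mC mA mD).
have t4 : symdist measure01 A D <= symdist measure01 A B + symdist measure01 D B.
  by rewrite (sC D B); exact: (symdist_triangle measure01T mA mB mD).
by rewrite ler_norml; apply/andP; split; lra.
Qed.

Let dist_approx n : `|(x - y) - ((val (p n)).1 - (val (q n)).1)| <= 8 / 2 ^+ n.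
Proof.
have [_ _ +] := Pp n; have [_ _ +] := Qq n; rewrite !ler_norml.
by move=> /andP[? ?] /andP[? ?]; apply/andP; split; lra.
Qed.

Lemma symdist_le_mdist : symdist measure01 A B <= mdist P Q.
Proof.
apply: (@le_add_geometric _ _ _ 20) => n.
have := level_le n; have := approx n; have := sym_approx n.
have := slit_domain_symdist_le (p n) (q n); have := e0 n.
rewrite !ler_norml => ? ? /andP[? ?] /andP[? ?]; lra.
Qed.

Lemma dist_le_mdist : `|x - y| <= mdist P Q.
Proof.
apply: (@le_add_geometric _ _ _ 10) => n.
have := level_le n; have := approx n; have := dist_approx n.
have := slit_domain_dist1 (p n) (q n); have := e0 n.
rewrite !ler_norml => ? /andP[? ?] /andP[? ?] /andP[? ?] ?; apply/andP; split; lra.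
Qed.

Lemma dist_le1 : `|x - y| <= 1.
Proof.
apply: (@le_add_geometric _ _ _ 8) => n; have := dist_approx n.
have [/andP[? ?] _] := slit_set_square (slit_domainP (p n)).
have [/andP[? ?] _] := slit_set_square (slit_domainP (q n)).
by rewrite !ler_norml => /andP[? ?]; apply/andP; split; lra.
Qed.

Lemma mdist_le_symdist :
  mdist P Q <= 47 * `|x - y| + 50 * symdist measure01 A B.
Proof.
(* 1300 bounds 2 + 60 + 47 * 8 + 50 * 16, the errors of [approx], of the estimate on M_n, of
   [dist_approx] and of [sym_approx]. *)
suff h n : mdist (val P n) (val Q n) <=
    47 * `|x - y| + 50 * symdist measure01 A B + 1300 / 2 ^+ n.
  apply: (@le_add_geometric _ _ _ 1300) => n.
  apply: (cvgr_to_le (@cvg_carpet_dist R P Q)).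
  exists n => // m /= nm; apply: le_trans (h m) _.
  by apply: lerD; [exact: lexx|exact: (ler_geometric (ler0n _ _) nm)].
have := approx n; have := sym_approx n.
have := slit_domain_le_symdist (p n) (q n); have := e0 n.
have := ler_normB (x - y) (x - y - ((val (p n)).1 - (val (q n)).1)).
have := dist_approx n; rewrite subKr.
move: (`|x - y|) (`|(val (p n)).1 - _|) (`|x - y - _|) => a b c.
rewrite !ler_norml => hc hb h0 h1 /andP[h2 h3] /andP[h4 h5]; lra.
Qed.

End comparison.

End carpet_embedding.

Theorem theorem1p2 (R : realType) :
  exists K : R, 1 <= K /\
    exists F : slit_carpet R -> L1_01 R, bi_lipschitz 1 K F.
Proof.
(* Let D and m be the distances of two points and of their images, w = |x - y|, and s the measure of
   the symmetric difference. With factor 400, m <= 400 (s + w/2) <= 600 D. Conversely s <= m/200 and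
   w <= 3m/200, so D <= 47 w + 50 s <= (191/200) m. *)
exists 600; split; first by rewrite ler1n.
pose codes (P : slit_carpet R) (f : L1_space measure01) := exists q B X,
  [/\ measurable B, carpet_code P q B X & L1_fun f = cut_fun 400 B X %[ae measure01]].
have ex_code (P : slit_carpet R) : exists f, codes P f.
  have [q [B [X [mB PB]]]] := exists_carpet_code P.
  have [f hf] := exists_cut_L1 measure01T 400 X mB.
  by exists f, q, B, X.
have [F FP] := choice ex_code.
exists F => P Q.
have [p [A [x [mA PA FA]]]] := FP P; have [q [B [y [mB QB FB]]]] := FP Q.
have M0 : 0 <= 400 :> R by rewrite ler0n.
have xy1 := dist_le1 PA QB.
have h1 := mdist_cut_le measure01T M0 mA mB FA FB.
have h2 := symdist_le_mdist_cut measure01T M0 xy1 mA mB FA FB.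
have h3 := dist_le_mdist_cut measure01T M0 mA mB FA FB.
have h4 := symdist_le_mdist mA mB PA QB.
have h5 := dist_le_mdist PA QB.
have h6 := mdist_le_symdist mA mB PA QB.
move: (mdist (F P) (F Q)) (mdist P Q) (`|x - y|) (symdist measure01 A B)
  h1 h2 h3 h4 h5 h6 => m D w s h1 h2 h3 h4 h5 h6.
by apply/andP; split; lra.
Qed.
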